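(* Let $(X,\mathcal{A},\mu,T)$ be an ergodic probability preserving system, and $(A_l)_{l\geq1}$ a sequence of asymptotically rare events. Let $\nu_l:=\mu_{A_l}$ and assume there are measurable $\tau_l:X\to\mathbb{N}_0$ such that (1) $\mu(A_l)\tau_l\to0$ in $\nu_l$-probability, (2) $\nu_l(\tau_l<\varphi_{A_l})\to1$, and (3) there is a compact subset $\mathfrak{K}$ of $(\mathfrak{P},d_{\mathfrak{P}})$ with $T^{\tau_l}_\ast\nu_l\in\mathfrak{K}$ for all $l\geq1$. Then $(A_l)$ exhibits Poisson asymptotics: $$\mu(A_l)\Phi_{A_l}\overset{\mu_{A_l}}{\Longrightarrow}\Phi_{\mathrm{Exp}}\quad\text{and}\quad \mu(A_l)\Phi_{A_l}\overset{\mu}{\Longrightarrow}\Phi_{\mathrm{Exp}}\qquad\text{as }l\to\infty.$$ More generally, the same conclusion holds provided that for every $\varepsilon>0$ there are a sequence $(\nu_l)_{l\ge1}$ in $\mathfrak{P}$ with $d_{\mathfrak{P}}(\nu_l,\mu_{A_l})<\varepsilon$ for all $l$, a compact set $\mathfrak{K}\subseteq\mathfrak{P}$, and measurable $\tau_l:X\to\mathbb{N}_0$ such that (1)–(3) hold for these $\nu_l$.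
   Context: $T$ is an ergodic measure-preserving map of the probability space $(X,\mathcal{A},\mu)$. For $A\in\mathcal{A}$, $\mu(A)>0$: $\varphi_A(x):=\inf\{n\ge1:T^nx\in A\}$, $T_Ax:=T^{\varphi_A(x)}x$, $\mu_A(B):=\mu(A\cap B)/\mu(A)$, and $\Phi_A:=(\varphi_A,\varphi_A\circ T_A,\varphi_A\circ T_A^2,\ldots)$, a random element of $[0,\infty]^{\mathbb{N}_0}$ (with $[0,\infty]$ metrized by $|e^{-s}-e^{-t}|$ and the product metric $\sum_j2^{-(j+1)}d(s^{(j)},t^{(j)})$). $(A_l)$ asymptotically rare means $A_l\in\mathcal{A}$, $0<\mu(A_l)\to0$. $\mathfrak{P}$: probability measures $\nu\ll\mu$, with $d_{\mathfrak{P}}(\nu,\nu')=2\sup_A|\nu(A)-\nu'(A)|$. $T^\tau x:=T^{\tau(x)}x$, $T^\tau_\ast\nu:=\nu\circ(T^\tau)^{-1}$. $\Phi_{\mathrm{Exp}}$ denotes an iid sequence of standard (mean one) exponential random variables. $R_l\overset{\nu_l}{\Longrightarrow}R$ means weak convergence of $\nu_l\circ R_l^{-1}$ to the law of $R$. *)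

(* Defs.v *)
From HB Require Import structures.
From mathcomp Require Import all_boot all_order all_algebra.
From mathcomp Require Import all_classical all_reals all_analysis.
Set Implicit Arguments. Unset Strict Implicit. Unset Printing Implicit Defensive.
Import Order.TTheory GRing.Theory Num.Theory.
Import numFieldNormedType.Exports.
Local Open Scope classical_set_scope.
Local Open Scope ring_scope.

Section Defs.
Context {d : measure_display} {X : measurableType d} {R : realType}.
Local Open Scope ereal_scope.

Definition measure_preserving (mu : {measure set X -> \bar R}) (T : X -> X) :=
  measurable_fun setT T /\ forall B, measurable B -> mu (T @^-1` B) = mu B.

Definition ergodic (mu : {measure set X -> \bar R}) (T : X -> X) :=
  forall B, measurable B -> T @^-1` B = B -> mu B = 0 \/ mu B = 1.

(** first hitting time phi_A x = inf {n >= 1 | T^n x \in A}  (inf set0 = +oo) *)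
Definition hit_time (T : X -> X) (A : set X) (x : X) : \bar R :=
  ereal_inf [set (n%:R)%:E | n in [set n : nat | (0 < n)%N /\ A (iter n T x)]].

(** first return map T_A x = T^(phi_A x) x  (set to x where phi_A x = +oo) *)
Definition induced_map (T : X -> X) (A : set X) (x : X) : X :=
  xget x [set y | exists n : nat, hit_time T A x = (n%:R)%:E /\ y = iter n T x].

Definition scaled_Phi (mu : {measure set X -> \bar R}) (T : X -> X) (A : set X)
  (x : X) : nat -> \bar R :=
  fun j => mu A * hit_time T A (iter j (induced_map T A) x).

(** conditional measure mu_A (B) = mu (A `&` B) / mu A  (for 0 < mu A < oo) *)
Definition condm (mu : probability X R) (A : set X) (mA : measurable A) :=
  mnormalize (mrestr mu mA) mu.

(** the space frakP: probability measures absolutely continuous wrt mu,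
    viewed as set functions *)
Definition inP (mu : {measure set X -> \bar R}) (nu : set X -> \bar R) :=
  [/\ nu set0 = 0, (forall B, measurable B -> 0 <= nu B),
      semi_sigma_additive nu, nu setT = 1 &
      (forall B, measurable B -> mu B = 0 -> nu B = 0)].

Definition dP (nu nu' : set X -> \bar R) : \bar R :=
  2%:E * ereal_sup [set `|nu B - nu' B| | B in [set B : set X | measurable B]].

Definition dP_open (mu : {measure set X -> \bar R}) (U : set (set X -> \bar R)) :=
  U `<=` inP mu /\
  forall nu, U nu -> exists r : R, (0 < r)%R /\
    forall nu', inP mu nu' -> dP nu nu' < r%:E -> U nu'.

Definition dP_compact (mu : {measure set X -> \bar R}) (K : set (set X -> \bar R)) :=
  K `<=` inP mu /\
  forall (I : Type) (U : I -> set (set X -> \bar R)),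
    (forall i, dP_open mu (U i)) -> K `<=` \bigcup_i U i ->
    exists F : set I, finite_set F /\ K `<=` \bigcup_(i in F) U i.

Definition Ttau (T : X -> X) (tau : X -> nat) (x : X) : X := iter (tau x) T x.

Definition pushf (nu : set X -> \bar R) (g : X -> X) : set X -> \bar R :=
  fun B => nu (g @^-1` B).

Definition conditions123 (mu : {measure set X -> \bar R}) (T : X -> X)
  (A : nat -> set X) (nu : nat -> set X -> \bar R) (tau : nat -> X -> nat) :=
  [/\ (forall l, measurable_fun setT (tau l)),
      (forall eps : R, (0 < eps)%R ->
         nu l [set x | eps%:E < mu (A l) * ((tau l x)%:R)%:E] @[l --> \oo] --> 0),
      nu l [set x | ((tau l x)%:R)%:E < hit_time T (A l) x] @[l --> \oo] --> 1 &
      exists K, dP_compact mu K /\ forall l, K (pushf (nu l) (Ttau T (tau l)))].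

End Defs.

Section Limit.
Context {R : realType}.
Local Open Scope ereal_scope.

(** product metric on [0,oo]^N:  sum_j 2^-(j+1) |e^-s_j - e^-t_j|  *)
Definition expN (s : \bar R) : R :=
  match s with EFin r => expR (- r) | _ => 0%R end.

Definition dseq (s t : nat -> \bar R) : \bar R :=
  \sum_(j <oo) ((2%:R ^- j.+1)%R * `|expN (s j) - expN (t j)|%R)%:E.

Definition nonneg_seq (s : nat -> \bar R) := forall j, 0 <= s j.

Definition bcont (f : (nat -> \bar R) -> R) :=
  (exists M : R, forall s, nonneg_seq s -> (`|f s| <= M)%R) /\
  forall s, nonneg_seq s -> forall e : R, (0 < e)%R -> exists delta : R,
    (0 < delta)%R /\ forall t, nonneg_seq t -> dseq s t < delta%:E ->
      (`|f s - f t| < e)%R.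

Definition iid_Exp1 {d'} {Om : measurableType d'} (P : probability Om R)
  (E : Om -> nat -> R) :=
  [/\ (forall w j, (0 <= E w j)%R),
      (forall j, measurable_fun setT (fun w => E w j)),
      (forall j (B : set R), measurable B ->
         P ((fun w => E w j) @^-1` B) = exponential_prob 1%R B) &
      (forall (n : nat) (B : nat -> set R), (forall j, measurable (B j)) ->
         P (\bigcap_(j in `I_n) ((fun w => E w j) @^-1` B j)) =
         \prod_(j < n) P ((fun w => E w j) @^-1` B j))].

Definition weak_cvg_Exp {d} {X : measurableType d}
  (nu : nat -> {measure set X -> \bar R}) (Rl : nat -> X -> nat -> \bar R) :=
  forall d' (Om : measurableType d') (P : probability Om R) (E : Om -> nat -> R),
    iid_Exp1 P E ->
    forall f, bcont f ->
      \int[nu l]_x (f (Rl l x))%:E @[l --> \oo] -->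
      \int[P]_w (f (fun j => (E w j)%:E))%:E.

End Limit.

(* Main.v *)
Require Import Defs.
From HB Require Import structures.
From mathcomp Require Import all_boot all_order all_algebra.
From mathcomp Require Import all_classical all_reals all_analysis.
From mathcomp Require Import measurable_realfun ring lra.
Set Implicit Arguments. Unset Strict Implicit. Unset Printing Implicit Defensive.
Import Order.TTheory GRing.Theory Num.Theory.
Import numFieldNormedType.Exports.
Local Open Scope classical_set_scope.
Local Open Scope ring_scope.

(** Write [h = mu A] and let [F = prod_j exp (- k_j h phi_A o T_A^j)] be a
    monomial in the Laplace factors of the return process, [G] the same monomial
    without its first factor.  Invariance of [mu] under [T], applied to [F] and
    split according to whether [T x] lies in [A], gives the exact identity
      [((exp (k_0 h) - 1) / h) * int F dmu = int G dmu_A - int F dmu_A].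
    Hence, if [int F dmu - int F dmu_A -> 0] along the rare events, induction on
    the number of factors gives [int F dmu_A -> prod_j 1 / (1 + k_j)], which is
    the moment of an iid standard exponential sequence, and moments of the
    variables [exp (- s_j)] determine weak convergence on [[0, oo]^N].

    To compare [mu] and [mu_A]: [F] changes by at most [k_0 h] along [T] outside
    [T^-1 A].  Delaying by [tau] therefore does not matter, so that [mu_A] may be
    replaced by a measure from the compact set [K].  For a fixed [rho << mu], the
    mean ergodic theorem and [int |F o T - F| dmu -> 0] give
    [int F drho - int F dmu -> 0], and compactness makes this uniform on [K]. *)

(** * Bounded measurable functions *)

(** The value [1 / (1 + k)] is forced by the identity: its left factor tends to [k_0], so if [a] is
    the common limit of the two integrals of [F] and [L] that of the integral of [G], then
    [k_0 a = L - a]. Convergence under [mu_A] and under [mu] therefore comes out of one induction.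
    Two obstacles shape the rest. The function [F] changes with the event, so no ergodic theorem for
    a fixed function applies to it. The time averages are put on the density of [rho] instead: with
    a bounded approximation [w] of that density, [F w] and [F (w o T^i)] have nearly the same
    integral, and the averages of [w o T^i] over [i < n] are close to a constant. Here [n] is fixed
    before the events become rare. Secondly, weak convergence is tested on all bounded continuous
    functions on an infinite product. The coordinates [exp (- s_j)] carry it to the cube [[0, 1]^N],
    where compactness yields a modulus of continuity in finitely many coordinates and Bernstein
    polynomials reduce everything to monomials. *)

Definition bounded_measurable d (X : measurableType d) (R : realType)
  (f : X -> R) := measurable_fun setT f /\ exists C : R, forall x, `|f x| <= C.

Section BoundedMeasurable.
Context d (X : measurableType d) (R : realType).
Implicit Types (f g : X -> R) (P : probability X R).

Lemma bm_cst (c : R) : bounded_measurable (fun _ : X => c).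
Proof. by split; [exact: measurable_cst|exists `|c|]. Qed.

Lemma bmD f g : bounded_measurable f -> bounded_measurable g ->
  bounded_measurable (fun x => f x + g x).
Proof.
move=> [mf [C fC]] [mg [D gD]]; split; first exact: measurable_funD.
by exists (C + D) => x; rewrite (le_trans (ler_normD _ _))// lerD.
Qed.

Lemma bmN f : bounded_measurable f -> bounded_measurable (fun x => - f x).
Proof.
move=> [mf [C fC]]; split; last by exists C => x; rewrite normrN.
exact: measurableT_comp mf.
Qed.

Lemma bmB f g : bounded_measurable f -> bounded_measurable g ->
  bounded_measurable (fun x => f x - g x).
Proof. by move=> bf bg; apply: bmD bf (bmN bg). Qed.

Lemma bmM f g : bounded_measurable f -> bounded_measurable g ->
  bounded_measurable (fun x => f x * g x).
Proof.
move=> [mf [C fC]] [mg [D gD]]; split; first exact: measurable_funM.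
by exists (C * D) => x; rewrite normrM ler_pM.
Qed.

Lemma bmZ c f : bounded_measurable f -> bounded_measurable (fun x => c * f x).
Proof. by move=> bf; apply: bmM => //; exact: bm_cst. Qed.

Lemma bm_norm f : bounded_measurable f -> bounded_measurable (fun x => `|f x|).
Proof.
move=> [mf [C fC]]; split; first exact: measurableT_comp.
by exists C => x; rewrite normr_id.
Qed.

Lemma bm_max f g : bounded_measurable f -> bounded_measurable g ->
  bounded_measurable (fun x => Num.max (f x) (g x)).
Proof.
move=> [mf [C fC]] [mg [D gD]]; split; first exact: measurable_maxr.
exists (C + D) => x; have C0 := le_trans (normr_ge0 _) (fC x).
have D0 := le_trans (normr_ge0 _) (gD x).
rewrite maxEle; case: ifP => _; first by rewrite (le_trans (gD x))// lerDr.
by rewrite (le_trans (fC x))// lerDl.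
Qed.

Lemma bmX f n : bounded_measurable f -> bounded_measurable (fun x => f x ^+ n).
Proof.
move=> bf; elim: n => [|n ih].
  by rewrite (_ : (fun _ => _) = cst 1) //; exact: bm_cst.
rewrite (_ : (fun _ => _) = (fun x => f x * f x ^+ n)); first exact: bmM.
by apply/funext => x; rewrite exprS.
Qed.

Lemma bm_sum (I : Type) (s : seq I) (p : pred I) (F : I -> X -> R) :
  (forall i, p i -> bounded_measurable (F i)) ->
  bounded_measurable (fun x => \sum_(i <- s | p i) F i x).
Proof.
move=> bF; elim: s => [|i s ih].
  by rewrite (_ : (fun _ => _) = cst 0); [exact: bm_cst|
    apply/funext => x; rewrite big_nil].
have [pi|pi] := boolP (p i); last first.
  by under eq_fun => x do rewrite big_cons (negbTE pi).
by under eq_fun => x do rewrite big_cons pi; apply: bmD => //; exact: bF.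
Qed.

Lemma bm_prod (I : Type) (s : seq I) (p : pred I) (F : I -> X -> R) :
  (forall i, p i -> bounded_measurable (F i)) ->
  bounded_measurable (fun x => \prod_(i <- s | p i) F i x).
Proof.
move=> bF; elim: s => [|i s ih].
  by rewrite (_ : (fun _ => _) = cst 1); [exact: bm_cst|
    apply/funext => x; rewrite big_nil].
have [pi|pi] := boolP (p i); last first.
  by under eq_fun => x do rewrite big_cons (negbTE pi).
by under eq_fun => x do rewrite big_cons pi; apply: bmM => //; exact: bF.
Qed.

Lemma bm_indic (B : set X) : measurable B -> bounded_measurable (\1_B : X -> R).
Proof.
move=> mB; split; first exact: measurable_indic.
by exists 1 => x; rewrite indicE; case: (_ \in _); rewrite ?normr1 ?normr0.
Qed.

Lemma bm_comp d' (Y : measurableType d') (h : Y -> X) f :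
  measurable_fun setT h -> bounded_measurable f ->
  bounded_measurable (fun y => f (h y)).
Proof.
move=> mh [mf [C fC]]; split; last by exists C => y; exact: fC.
exact: measurableT_comp.
Qed.

Lemma bm_integrable P f : bounded_measurable f ->
  P.-integrable setT (EFin \o f).
Proof.
move=> [mf [C fC]]; apply: measurable_bounded_integrable => //=.
  by rewrite probability_setT ltry.
exists C; split; first exact: num_real.
by move=> M CM x _; exact: (le_trans (fC x) (ltW CM)).
Qed.

Lemma EFin_Rint P f : bounded_measurable f ->
  (\int[P]_x f x)%:E = (\int[P]_x (f x)%:E)%E.
Proof.
by move=> bf; rewrite /Rintegral fineK//; apply: integrable_fin_num => //;
  exact: bm_integrable.
Qed.

Lemma RintD P f g : bounded_measurable f -> bounded_measurable g ->
  \int[P]_x (f x + g x) = \int[P]_x f x + \int[P]_x g x.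
Proof. by move=> bf bg; apply: RintegralD => //; exact: bm_integrable. Qed.

Lemma RintB P f g : bounded_measurable f -> bounded_measurable g ->
  \int[P]_x (f x - g x) = \int[P]_x f x - \int[P]_x g x.
Proof. by move=> bf bg; apply: RintegralB => //; exact: bm_integrable. Qed.

Lemma RintZ P c f : bounded_measurable f ->
  \int[P]_x (c * f x) = c * \int[P]_x f x.
Proof. by move=> bf; apply: RintegralZl => //; exact: bm_integrable. Qed.

Lemma le_Rint P f g : bounded_measurable f -> bounded_measurable g ->
  (forall x, f x <= g x) -> \int[P]_x f x <= \int[P]_x g x.
Proof. by move=> bf bg fg; apply: le_Rintegral => //; exact: bm_integrable. Qed.

Lemma Rint_cst P c : \int[P]_x c = c.
Proof.
rewrite Rintegral_cst// -[RHS]mulr1; congr (_ * _).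
exact: (congr1 fine (probability_setT P)).
Qed.

Lemma Rint_indic P (B : set X) : measurable B -> \int[P]_x \1_B x = fine (P B).
Proof. by move=> mB; rewrite /Rintegral integral_indic// setIT. Qed.

Lemma Rint_sum P (I : Type) (s : seq I) (p : pred I) (F : I -> X -> R) :
  (forall i, p i -> bounded_measurable (F i)) ->
  \int[P]_x (\sum_(i <- s | p i) F i x) = \sum_(i <- s | p i) \int[P]_x F i x.
Proof.
move=> bF; elim: s => [|i s ih].
  under eq_Rintegral => x _ do rewrite big_nil.
  by rewrite Rint_cst big_nil.
rewrite big_cons; have [pi|pi] := boolP (p i); last first.
  by under eq_Rintegral => x _ do rewrite big_cons (negbTE pi).
under eq_Rintegral => x _ do rewrite big_cons pi.
rewrite RintD ?ih//; first exact: bF.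
exact: bm_sum.
Qed.

Lemma Rint_dist P f g h : bounded_measurable f -> bounded_measurable g ->
  bounded_measurable h -> (forall x, `|f x - g x| <= h x) ->
  `|\int[P]_x f x - \int[P]_x g x| <= \int[P]_x h x.
Proof.
move=> bf bg bh fgh; rewrite -RintB//.
have bfg := bmB bf bg.
apply: (le_trans (le_normr_Rintegral _ (bm_integrable P bfg))) => //.
by apply: le_Rint => //; exact: bm_norm.
Qed.

Lemma Rint_dist_cst P f g c : bounded_measurable f -> bounded_measurable g ->
  (forall x, `|f x - g x| <= c) -> `|\int[P]_x f x - \int[P]_x g x| <= c.
Proof.
move=> bf bg fgc; rewrite -[leRHS](Rint_cst P); apply: Rint_dist => //.
exact: bm_cst.
Qed.

Lemma eq_Rint_measure P P' f : (forall B, measurable B -> P B = P' B) ->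
  \int[P]_x f x = \int[P']_x f x.
Proof.
by move=> PP'; rewrite /Rintegral (eq_measure_integral P')// => B mB _; exact: PP'.
Qed.

End BoundedMeasurable.

Lemma probability_fine d (X : measurableType d) (R : realType)
  (P : probability X R) (B : set X) : measurable B -> (fine (P B))%:E = P B.
Proof. by move=> mB; rewrite fineK// fin_num_measure. Qed.

Lemma Rint_transport d d' (X : measurableType d) (Y : measurableType d')
  (R : realType) (P : probability X R) (Q : probability Y R) (phi : X -> Y)
  (f : Y -> R) : measurable_fun setT phi -> bounded_measurable f ->
  (forall B, measurable B -> Q B = P (phi @^-1` B)) ->
  \int[Q]_y f y = \int[P]_x f (phi x).
Proof.
move=> mphi bf QP; rewrite /Rintegral; congr fine.
have mf : measurable_fun setT (EFin \o f) by apply/measurable_EFinP; case: bf.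
have bfphi := bm_comp mphi bf.
transitivity (\int[pushforward P phi]_y (EFin \o f) y)%E.
  have QP' B : measurable B -> B `<=` setT -> Q B = pushforward P phi B.
    by move=> mB _; exact: QP.
  by rewrite (eq_measure_integral (pushforward P phi) QP').
rewrite (@integral_pushforward _ _ _ _ _ phi mphi P setT (EFin \o f) mf)//.
exact: (bm_integrable P bfphi).
Qed.

(** * Approximation by averages of indicators *)

Section Layers.
Context d (X : measurableType d) (R : realType).
Variables (g : X -> R) (bg : bounded_measurable g) (g01 : forall x, 0 <= g x <= 1).

Definition layer (N k : nat) : set X := [set x | k.+1%:R / N%:R <= g x].

(** A discrete layer-cake formula. Being an average of indicators, it carries a bound valid for
    every measurable set over to integrals with the same constant. *)
Definition layer_mean (N : nat) (x : X) : R :=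
  N%:R^-1 * \sum_(k < N) \1_(layer N k) x.

Lemma measurable_layer N k : measurable (layer N k).
Proof.
rewrite /layer -[X in measurable X]setTI.
exact: (measurable_fun_le measurableT (measurable_cst _) bg.1).
Qed.

Lemma bm_layer_mean N : bounded_measurable (layer_mean N).
Proof.
apply: bmZ; apply: bm_sum => i _; apply: bm_indic; exact: measurable_layer.
Qed.

(** [S] is the minimum of [N] and the integer part of [t]; these three inequalities are what
    induction on [N] preserves. *)
Lemma sum_thresholds (t : R) (N : nat) : 0 <= t ->
  let S := \sum_(k < N) (k.+1%:R <= t)%R%:R in
  [/\ S <= t, S <= N%:R & N%:R <= S \/ t - 1 <= S].
Proof.
move=> t0 /=; elim: N => [|N [ih1 ih2 ih3]].
  by rewrite big_ord0; split => //; left.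
rewrite big_ord_recr/=; set S := \sum_(k < N) _ in ih1 ih2 ih3 *.
have -> : N.+1%:R = N%:R + 1 :> R by rewrite natr1.
case: (leP (N%:R + 1) t) => Nt /=; split; try lra.
Qed.

Lemma layer_mean_dist N x : (0 < N)%N -> `|g x - layer_mean N x| <= N%:R^-1.
Proof.
move=> N0; have N0R : 0 < N%:R :> R by rewrite ltr0n.
have /andP[g0 g1] := g01 x.
have gN : 0 <= g x * N%:R by rewrite mulr_ge0// ltW.
have := @sum_thresholds (g x * N%:R) N gN; set S := \sum_(k < N) _.
move=> [S1 S2 S3].
have -> : layer_mean N x = N%:R^-1 * S.
  congr (_ * _); apply: eq_bigr => k _; rewrite indicE.
  by congr (nat_of_bool _)%:R; apply/idP/idP; rewrite inE /layer/= ler_pdivrMr.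
have -> : g x - N%:R^-1 * S = N%:R^-1 * (g x * N%:R - S).
  by rewrite mulrBr mulrCA mulVf ?mulr1// gt_eqF.
have N0V : 0 < N%:R^-1 :> R by rewrite invr_gt0.
rewrite normrM (gtr0_norm N0V) -[leRHS]mulr1 ler_pM2l// ger0_norm; last first.
  by rewrite subr_ge0.
have gN1 : g x * N%:R <= N%:R by rewrite ler_piMl// ltW.
by case: S3; lra.
Qed.

End Layers.

(** * Integrals against an integrable weight *)

Section WeightedIntegral.
Context d (X : measurableType d) (R : realType) (P : {measure set X -> \bar R}).
Implicit Types f W : X -> R.

Lemma integrable_bmM f W : bounded_measurable f ->
  P.-integrable setT (EFin \o W) ->
  P.-integrable setT (EFin \o (fun x => f x * W x)).
Proof.
move=> [mf [C fC]] iW.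
have iCW : P.-integrable setT (EFin \o (fun x => C * W x)).
  by have := integrableZl measurableT C iW; apply: eq_integrable.
apply: (le_integrable measurableT _ _ iCW).
  apply/measurable_EFinP; apply: measurable_funM => //.
  by apply/measurable_EFinP; exact: measurable_int iW.
move=> x _ /=; rewrite lee_fin !normrM ler_wpM2r//.
by rewrite (le_trans (fC x))// ler_norm.
Qed.

Lemma Rintegral_sum_mul (N : nat) (F : nat -> X -> R) W :
  (forall k, bounded_measurable (F k)) -> P.-integrable setT (EFin \o W) ->
  \int[P]_x ((\sum_(k < N) F k x) * W x) = \sum_(k < N) \int[P]_x (F k x * W x).
Proof.
move=> bF iW; elim: N => [|N ih].
  rewrite big_ord0; under eq_Rintegral => x _ do rewrite big_ord0 mul0r.
  by rewrite Rintegral_cst// mul0r.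
rewrite big_ord_recr/= -ih.
under eq_Rintegral => x _ do rewrite big_ord_recr/= mulrDl.
rewrite RintegralD//; apply: integrable_bmM => //; exact: bm_sum.
Qed.

End WeightedIntegral.

Lemma bm_integrable_cst d (X : measurableType d) (R : realType)
  (P : probability X R) (c : R) : P.-integrable setT (EFin \o (fun=> c)).
Proof. by apply: bm_integrable; exact: bm_cst. Qed.

(** Both sides are within a multiple of [1 / N] of their [layer_mean] versions, which agree by
    hypothesis. The weights make one statement serve conditional measures, the exponential density
    on Lebesgue measure, and independence. *)
Lemma Rint_weighted_eq d1 d2 d3 (X1 : measurableType d1) (X2 : measurableType d2)
  (Y : measurableType d3) (R : realType) (P1 : {measure set X1 -> \bar R})
  (P2 : {measure set X2 -> \bar R}) (phi1 : X1 -> Y) (phi2 : X2 -> Y)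
  (W1 : X1 -> R) (W2 : X2 -> R) :
  measurable_fun setT phi1 -> measurable_fun setT phi2 ->
  P1.-integrable setT (EFin \o W1) -> P2.-integrable setT (EFin \o W2) ->
  (forall B, measurable B -> \int[P1]_x (\1_B (phi1 x) * W1 x) =
                             \int[P2]_x (\1_B (phi2 x) * W2 x)) ->
  forall g : Y -> R, bounded_measurable g -> (forall y, 0 <= g y <= 1) ->
  \int[P1]_x (g (phi1 x) * W1 x) = \int[P2]_x (g (phi2 x) * W2 x).
Proof.
move=> m1 m2 iW1 iW2 ind_eq g bg g01.
have close d' (X : measurableType d') (P : {measure set X -> \bar R})
    (phi : X -> Y) (W : X -> R) : measurable_fun setT phi ->
    P.-integrable setT (EFin \o W) ->
    exists2 C : R, 0 <= C & forall N, (0 < N)%N ->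
    `|\int[P]_x (g (phi x) * W x) -
      N%:R^-1 * \sum_(k < N) \int[P]_x (\1_(layer g N k) (phi x) * W x)| <=
    C * N%:R^-1.
  move=> mphi iW; exists (\int[P]_x `|W x|); first exact: Rintegral_ge0.
  move=> N N0; have N0R : 0 < N%:R :> R by rewrite ltr0n.
  have bi k : bounded_measurable (fun x => \1_(layer g N k) (phi x) : R).
    by apply: (bm_comp mphi (bm_indic _ _)); exact: measurable_layer.
  have bL : bounded_measurable (fun x => layer_mean g N (phi x)).
    exact: (bm_comp mphi (bm_layer_mean bg N)).
  have bgp := bm_comp mphi bg.
  have bgL := bmB bgp bL.
  have iaW : P.-integrable setT (EFin \o (fun x => `|W x|)).
    by have := integrable_norm iW.
  rewrite -(@Rintegral_sum_mul _ _ _ P N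
    (fun k x => \1_(layer g N k) (phi x)) W bi iW) -RintegralZl//; last first.
    by apply: integrable_bmM => //; exact: bm_sum.
  under [X in _ - X]eq_Rintegral => x _ do rewrite mulrA -/(layer_mean g N (phi x)).
  rewrite -RintegralB//; [|exact: integrable_bmM..].
  under eq_Rintegral => x _ do rewrite -mulrBl.
  have igLW := integrable_bmM bgL iW.
  apply: (le_trans (le_normr_Rintegral _ igLW)) => //.
  rewrite -RintegralZr//; apply: le_Rintegral => //.
  - by have := integrable_norm igLW.
  - have := integrable_bmM (bm_cst X (N%:R^-1 : R)) iaW.
    by apply: eq_integrable => // x _ /=; rewrite mulrC.
  - by move=> x _; rewrite normrM mulrC ler_wpM2l// layer_mean_dist.
have [C1 C10 h1] := close _ _ P1 _ _ m1 iW1.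
have [C2 C20 h2] := close _ _ P2 _ _ m2 iW2.
apply/eqP; rewrite -subr_eq0 -normr_le0; apply/ler_addgt0Pr => c c0.
rewrite add0r; set C := C1 + C2.
have Cc : 0 <= C / c by rewrite divr_ge0 ?addr_ge0// ltW.
set N := (Num.bound (C / c)).+1.
have N0 : 0 < N%:R :> R by rewrite ltr0n.
have hN : C * N%:R^-1 <= c.
  rewrite ler_pdivrMr// mulrC -ler_pdivrMr//.
  by rewrite (le_trans (ltW (archi_boundP Cc)))// ler_nat.
apply: le_trans hN; rewrite mulrDl; have {}h2 := h2 N isT; have {}h1 := h1 N isT.
rewrite distrC in h2; apply: le_trans (lerD h1 h2).
under [X in _ <= _ + `|_ * X - _|]eq_bigr => k _.
  rewrite -ind_eq; last exact: measurable_layer.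
  over.
exact: ler_distD.
Qed.

(** * The mean ergodic theorem *)

Section Ergodic.
Context d (X : measurableType d) (R : realType) (mu : probability X R) (T : X -> X).
Hypothesis mp : measure_preserving mu T.
Hypothesis erg : ergodic mu T.
Implicit Types f w : X -> R.

Lemma measurable_iterT n : measurable_fun setT (iter n T).
Proof.
elim: n => [|n ih]; first exact: measurable_id.
by apply: (measurableT_comp mp.1 ih).
Qed.

Lemma Rint_comp_preserving f : bounded_measurable f ->
  \int[mu]_x f (T x) = \int[mu]_x f x.
Proof.
move=> bf; apply/esym; apply: Rint_transport mp.1 bf _ => B mB.
by rewrite mp.2.
Qed.

Definition birkhoff_sum f n x := \sum_(i < n) f (iter i T x).

Lemma bm_birkhoff_sum f n : bounded_measurable f ->
  bounded_measurable (birkhoff_sum f n).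
Proof.
move=> bf; apply: bm_sum => i _; apply: bm_comp => //.
exact: measurable_iterT.
Qed.

Lemma birkhoff_sumS f n x :
  birkhoff_sum f n.+1 x = f x + birkhoff_sum f n (T x).
Proof.
rewrite /birkhoff_sum big_ord_recl; congr (_ + _).
by apply: eq_bigr => i _; rewrite lift0 iterSr.
Qed.

Lemma Rint_birkhoff_sum f n : bounded_measurable f ->
  \int[mu]_x birkhoff_sum f n x = n%:R * \int[mu]_x f x.
Proof.
move=> bf; elim: n => [|n ih].
  under eq_Rintegral => x _ do rewrite /birkhoff_sum big_ord0.
  by rewrite Rint_cst mul0r.
under eq_Rintegral => x _ do rewrite birkhoff_sumS.
rewrite RintD//; last exact: bm_comp mp.1 (bm_birkhoff_sum n bf).
rewrite (@Rint_comp_preserving (birkhoff_sum f n)); last exact: bm_birkhoff_sum.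
by rewrite ih mulrSr mulrDl mul1r addrC.
Qed.

(* [max (0, S_1 f, ..., S_N f)], with [S_n f = birkhoff_sum f n], written as a
   recursion so that Garsia's inequality can be read off. *)
Fixpoint birkhoff_max f N x : R :=
  if N is N'.+1 then Num.max 0 (f x + birkhoff_max f N' (T x)) else 0.

Lemma bm_birkhoff_max f N : bounded_measurable f ->
  bounded_measurable (birkhoff_max f N).
Proof.
move=> bf; elim: N => [|N ih] /=; first exact: bm_cst.
apply: bm_max; first exact: bm_cst.
by apply: bmD => //; exact: bm_comp mp.1 ih.
Qed.

Lemma birkhoff_max_ge0 f N x : 0 <= birkhoff_max f N x.
Proof. by case: N => //= N; rewrite le_max lexx. Qed.

Lemma birkhoff_max_leS f N x : birkhoff_max f N x <= birkhoff_max f N.+1 x.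
Proof.
elim: N x => [|N ih] x; first exact: birkhoff_max_ge0.
have := ih (T x); rewrite /= => h.
by rewrite ge_max !le_max lexx/= lerD2l h orbT.
Qed.

Lemma birkhoff_sum_le_max f n N x : (n <= N)%N ->
  birkhoff_sum f n x <= birkhoff_max f N x.
Proof.
elim: N n x => [|N ih] [|n] x // nN; try by rewrite /birkhoff_sum big_ord0 birkhoff_max_ge0.
by rewrite birkhoff_sumS/= le_max lerD2l ih// orbT.
Qed.

Definition birkhoff_pos f N := [set x | 0 < birkhoff_max f N.+1 x].

Lemma measurable_birkhoff_pos f N : bounded_measurable f ->
  measurable (birkhoff_pos f N).
Proof.
move=> bf; have [mM _] := bm_birkhoff_max N.+1 bf.
rewrite /birkhoff_pos -[X in measurable X]setTI.
have -> : [set x | 0 < birkhoff_max f N.+1 x] =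
  birkhoff_max f N.+1 @^-1` `]0, +oo[%classic.
  by apply/seteqP; split => x /=; rewrite in_itv/= andbT.
exact: mM.
Qed.

(** Write [M] for [birkhoff_max f N.+1]. Where [M > 0], the recursion and monotonicity in [N] give
    [M <= f + M o T]; elsewhere [M = 0 <= M o T]. So [f] times the indicator dominates [M - M o T],
    whose integral vanishes by invariance. *)
Lemma maximal_ergodic f N : bounded_measurable f ->
  0 <= \int[mu]_x (f x * \1_(birkhoff_pos f N) x).
Proof.
move=> bf; have bM := bm_birkhoff_max N.+1 bf.
have bi := @bm_indic _ _ R _ (measurable_birkhoff_pos N bf).
have -> : 0 = \int[mu]_x (birkhoff_max f N.+1 x - birkhoff_max f N.+1 (T x)).
  by rewrite RintB// ?Rint_comp_preserving// ?subrr//; exact: bm_comp mp.1 bM.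
apply: le_Rint.
- by apply: bmB => //; exact: bm_comp mp.1 bM.
- exact: bmM.
move=> x; rewrite indicE; have [xP|xP] := pselect (birkhoff_pos f N x).
  rewrite (mem_set xP); move: xP; rewrite /birkhoff_pos /=.
  have := birkhoff_max_leS f N (T x); rewrite /= lt_max ltxx/= => h pos.
  by rewrite (max_idPr (ltW pos)) mulr1 lerBlDr lerD2l.
rewrite (memNset xP) mulr0; move: xP; rewrite /birkhoff_pos /=.
move=> /negP; rewrite -leNgt => npos.
have -> : Num.max 0 (f x + birkhoff_max f N (T x)) = 0.
  by apply/eqP; rewrite eq_le npos le_max lexx.
by rewrite sub0r oppr_le0 -/(birkhoff_max f N.+1 (T x)) birkhoff_max_ge0.
Qed.

(** The sets increase, so some [birkhoff_pos f N] misses mass at most [e / (C + 1)]; restricting the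
    integral to it costs at most [e]. *)
Lemma Rint_ge0_of_birkhoff_pos f : bounded_measurable f ->
  mu (\bigcup_N birkhoff_pos f N) = 1%E -> 0 <= \int[mu]_x f x.
Proof.
move=> bf G1; have [_ [C fC]] := bf.
have mG N := measurable_birkhoff_pos N bf.
have bi N := @bm_indic _ _ R _ (mG N).
have : (fine \o (mu \o birkhoff_pos f)) N @[N --> \oo] --> (1 : R).
  apply/fine_cvg; rewrite -G1; apply: nondecreasing_cvg_mu => //.
    exact: bigcup_measurable.
  apply/nondecreasing_seqP => N; apply/subsetPset => x xP.
  exact: (lt_le_trans xP (birkhoff_max_leS f N.+1 x)).
move=> /cvgrPdist_le cvg1.
have C0 : 0 <= C by rewrite (le_trans _ (fC point)).
apply/ler_addgt0Pr => e e0.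
have eC : 0 < e / (C + 1) by rewrite divr_gt0// ltr_wpDl.
have [N _ /(_ N (leqnn N)) /= hN] := cvg1 _ eC.
have {}hN : \int[mu]_x (1 - \1_(birkhoff_pos f N) x) <= e / (C + 1).
  rewrite RintB//; last exact: bm_cst.
  by rewrite Rint_cst Rint_indic// (le_trans (ler_norm _)).
have : `|\int[mu]_x (f x * \1_(birkhoff_pos f N) x) - \int[mu]_x f x| <= e.
  apply: (@le_trans _ _ (\int[mu]_x (C * (1 - \1_(birkhoff_pos f N) x)))).
    apply: Rint_dist => //; first exact: bmM.
      by apply: bmZ; apply: bmB => //; exact: bm_cst.
    move=> x; rewrite -{2}[f x]mulr1 -mulrBr normrM ler_pM// -normrN opprB.
    by rewrite ger0_norm// subr_ge0 indicE; case: (_ \in _).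
  rewrite RintZ; last by apply: bmB => //; exact: bm_cst.
  apply: le_trans (ler_wpM2l C0 hN) _.
  by rewrite mulrA ler_pdivrMr ?ltr_wpDl// mulrDr mulr1 mulrC lerDl ltW.
have := @maximal_ergodic f N bf; rewrite ler_norml; lra.
Qed.

(** Unboundedness of the sums is used rather than a limsup of averages: for bounded [f], one more
    term moves the sums by a bounded amount, so this set equals its preimage exactly, as [ergodic]
    demands. *)
Definition birkhoff_unbounded f : set X :=
  \bigcap_(k : nat) \bigcup_(n : nat) [set x | k%:R <= birkhoff_sum f n x].

Lemma measurable_birkhoff_ge f n (c : R) : bounded_measurable f ->
  measurable [set x | c <= birkhoff_sum f n x].
Proof.
move=> bf; rewrite -[X in measurable X]setTI.
exact: (measurable_fun_le measurableT (measurable_cst _) (bm_birkhoff_sum n bf).1).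
Qed.

Lemma measurable_birkhoff_unbounded f : bounded_measurable f ->
  measurable (birkhoff_unbounded f).
Proof.
move=> bf; apply: bigcap_measurable => // k _; apply: bigcup_measurable => n _.
exact: measurable_birkhoff_ge.
Qed.

Lemma birkhoff_unbounded_invariant f : bounded_measurable f ->
  T @^-1` (birkhoff_unbounded f) = birkhoff_unbounded f.
Proof.
move=> [_ [C fC]]; have /archi_boundP := le_trans (normr_ge0 _) (fC point).
set c := Num.bound C => Cc.
have fc x : `|f x| <= c%:R by rewrite (le_trans (fC x))// ltW.
apply/seteqP; split => x xU k _.
  have [n _ /= h] := xU (k + c)%N I; exists n.+1 => //=.
  rewrite birkhoff_sumS; have := fc x; rewrite ler_norml natrD in h *; lra.
(* The extra [1] excludes the empty sum, so a first term is there to be split off. *)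
have [[|n] _ /=] := xU (k + c + 1)%N I.
  by rewrite /birkhoff_sum big_ord0 lern0 addn1.
rewrite birkhoff_sumS => h; exists n => //=.
have := fc x; rewrite ler_norml !natrD in h *; lra.
Qed.

(** Otherwise ergodicity gives the set measure one; each of its points has some sum at least [1],
    hence lies in a [birkhoff_pos], and the mean would be nonnegative. *)
Lemma birkhoff_unbounded_null f : bounded_measurable f -> \int[mu]_x f x < 0 ->
  mu (birkhoff_unbounded f) = 0%E.
Proof.
move=> bf f0; have mU := measurable_birkhoff_unbounded bf.
have [//|U1] := erg mU (birkhoff_unbounded_invariant bf).
exfalso; move: f0; rewrite ltNge => /negP; apply.
apply: Rint_ge0_of_birkhoff_pos => //; apply/eqP.
have mG : measurable (\bigcup_N birkhoff_pos f N).
  by apply: bigcup_measurable => N _; exact: measurable_birkhoff_pos.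
rewrite eq_le probability_le1//= -U1 le_measure ?inE// => x /(_ 1%N I)[n _ /= h].
exists n => //; rewrite /birkhoff_pos/=; apply: (lt_le_trans ltr01).
exact: le_trans h (birkhoff_sum_le_max f x (leqnSn n)).
Qed.

(** For [p] strictly between the mean and [q], [w - p] has negative mean, while [q n <= S_n w] means
    [(q - p) n <= S_n (w - p)]; if this happens infinitely often, the sums of [w - p] are
    unbounded. *)
Lemma birkhoff_limsup_null w (q : R) : bounded_measurable w ->
  \int[mu]_x w x < q ->
  mu (lim_sup_set (fun n => [set x | q * n%:R <= birkhoff_sum w n x])) = 0%E.
Proof.
move=> bw wq; set m := \int[mu]_x w x in wq.
set p := (m + q) / 2; have mp_ : m < p by rewrite /p; lra.
have pq : p < q by rewrite /p; lra.
have bf : bounded_measurable (fun x => w x - p) by apply: bmB => //; exact: bm_cst.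
have := @birkhoff_unbounded_null _ bf; rewrite RintB//; last exact: bm_cst.
rewrite Rint_cst subr_lt0 => /(_ mp_) U0.
apply/eqP; rewrite eq_le measure_ge0 andbT -U0 le_measure ?inE//.
- apply: bigcap_measurable => // k _; apply: bigcup_measurable => n _.
  exact: measurable_birkhoff_ge.
- exact: measurable_birkhoff_unbounded.
move=> x xL k _.
have [n /= kn xn] := xL (Num.bound (k%:R / (q - p))) I; exists n => //=.
have -> : birkhoff_sum (fun x => w x - p) n x = birkhoff_sum w n x - p * n%:R.
  by rewrite /birkhoff_sum sumrB sumr_const card_ord mulr_natr.
have qp0 : 0 < q - p by rewrite subr_gt0.
have : k%:R / (q - p) <= n%:R.
  have k0 : 0 <= k%:R / (q - p) by rewrite divr_ge0// ltW.
  by rewrite (le_trans (ltW (archi_boundP k0)))// ler_nat.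
rewrite ler_pdivrMr// => h; move: xn; rewrite /=; lra.
Qed.

(** Continuity from above along the tail unions turns a null limsup set into a small event at one
    time. *)
Lemma birkhoff_tail_small w (q e : R) : bounded_measurable w ->
  \int[mu]_x w x < q -> 0 < e ->
  exists2 n, (0 < n)%N &
    fine (mu [set x | q * n%:R <= birkhoff_sum w n x]) <= e.
Proof.
move=> bw wq e0; set F := fun n => [set x | q * n%:R <= birkhoff_sum w n x].
have mF n : measurable (F n) by exact: measurable_birkhoff_ge.
have mU n : measurable (\bigcup_(k >= n) F k) by exact: bigcup_measurable.
have : mu (\bigcup_(k >= n) F k) @[n --> \oo] --> mu (lim_sup_set F).
  by apply: lim_sup_set_cvg => //; rewrite (le_lt_trans (probability_le1 _ _)) ?ltry.
rewrite birkhoff_limsup_null// => /fine_cvgP[_ /cvgr0Pnorm_le/(_ _ e0)[N _ hN]].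
exists N.+1 => //; have := hN N.+1 (leqnSn N); rewrite /=; apply: le_trans.
apply: le_trans (ler_norm _); apply: fine_le; rewrite ?fin_num_measure//; first exact: mF.
apply: le_measure; rewrite ?inE; [exact: mF|exact: mU|].
by move=> x xF; exists N.+1 => /=.
Qed.

(** The upper tail alone suffices: the average [a] has mean [m], so the integral of [|a - m|] is
    twice that of its positive part. The latter is at most [e / 4] off [B] and at most [2 C] on [B],
    and [mu B <= e / (8 (C + 1))] keeps the contribution of [B] below [e / 2]. *)
Lemma mean_ergodic w (e : R) : bounded_measurable w -> 0 < e ->
  exists2 n, (0 < n)%N &
    \int[mu]_x `|n%:R^-1 * birkhoff_sum w n x - \int[mu]_x w x| <= e.
Proof.
move=> bw e0; have [_ [C wC]] := bw; set m := \int[mu]_x w x.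
have C0 : 0 <= C by rewrite (le_trans _ (wC point)).
have mC : `|m| <= C.
  rewrite -[m]subr0 -[X in m - X](Rint_cst mu); apply: Rint_dist_cst => //.
    exact: bm_cst.
  by move=> x; rewrite subr0.
have e4 : 0 < e / 4 by lra.
have mq : m < m + e / 4 by lra.
have d0 : 0 < e / (8 * (C + 1)) by rewrite divr_gt0//; lra.
have [n n0 hn] := birkhoff_tail_small bw mq d0.
exists n => //; have n0R : 0 < n%:R :> R by rewrite ltr0n.
set B := [set x | _] in hn.
have mB : measurable B by exact: measurable_birkhoff_ge.
set a := fun x => n%:R^-1 * birkhoff_sum w n x.
have ba : bounded_measurable a by apply: bmZ; exact: bm_birkhoff_sum.
have Ea : \int[mu]_x a x = m.
  rewrite RintZ; last exact: bm_birkhoff_sum.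
  by rewrite Rint_birkhoff_sum// mulKf// gt_eqF.
have aC x : `|a x| <= C.
  rewrite normrM gtr0_norm ?invr_gt0// ler_pdivrMl// /birkhoff_sum.
  apply: (le_trans (ler_norm_sum _ _ _)).
  apply: (@le_trans _ _ (\sum_(i < n) C)); first by apply: ler_sum.
  by rewrite sumr_const card_ord mulr_natl.
have bi := @bm_indic _ _ R _ mB.
have -> : e = \int[mu]_x (e / 2 + 4 * C * (e / (8 * (C + 1))) +
     (e / 2 - 4 * C * (e / (8 * (C + 1))))) by rewrite Rint_cst; lra.
apply: (@le_trans _ _ (\int[mu]_x (2 * (e / 4) + 4 * C * \1_B x - (a x - m)))).
  apply: le_Rint.
  - by apply: bm_norm; apply: bmB => //; exact: bm_cst.
  - apply: bmB; last by apply: bmB => //; exact: bm_cst.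
    by apply: bmD; [exact: bm_cst|exact: bmZ].
  move=> x; have /andP[mC1 mC2] : - C <= m <= C by rewrite -ler_norml.
  have /andP[aC1 aC2] : - C <= a x <= C by rewrite -ler_norml.
  rewrite -/(a x) indicE; have [h|h] := pselect (B x).
    by rewrite (mem_set h) mulr1; case: (ler0P (a x - m)); lra.
  rewrite (memNset h) mulr0; have : a x < m + e / 4.
    by rewrite /a ltr_pdivrMl// mulrC ltNge; apply/negP.
  by rewrite -/(a x) => h'; case: (ler0P (a x - m)); lra.
rewrite Rint_cst RintB; last 2 first.
- by apply: bmD; [exact: bm_cst|exact: bmZ].
- by apply: bmB => //; exact: bm_cst.
rewrite [X in _ - X]RintB//; last exact: bm_cst.
rewrite Ea Rint_cst subrr subr0 RintD; last 2 first.
- exact: bm_cst.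
- exact: bmZ.
rewrite Rint_cst RintZ// Rint_indic//.
have h1 : 4 * C * fine (mu B) <= 4 * C * (e / (8 * (C + 1))).
  by rewrite ler_wpM2l//; lra.
have : 4 * C * (e / (8 * (C + 1))) <= e / 2.
  rewrite mulrA ler_pdivrMr; last by lra.
  by rewrite mulrC -subr_ge0 (_ : _ - _ = 4 * e) ?mulr_ge0//; [lra|field].
lra.
Qed.

End Ergodic.

(** * Asymptotically invariant functions *)

Section DensityApprox.
Import HBSimple.

(** A simple function close in L1 to the Radon-Nikodym density serves as [w]. It is bounded, as
    [mean_ergodic] requires, and the error is uniform over all [f] bounded by one, so [f] may later
    vary with [l]. *)
Lemma density_approx d (X : measurableType d) (R : realType)
  (mu rho : probability X R) (e : R) :
  (forall B, measurable B -> mu B = 0%E -> rho B = 0%E) -> 0 < e ->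
  exists2 w : X -> R, bounded_measurable w &
    forall f : X -> R, bounded_measurable f -> (forall x, `|f x| <= 1) ->
      `|\int[rho]_x f x - \int[mu]_x (f x * w x)| <= e.
Proof.
move=> ac e0.
have rhomu : rho `<< mu by apply/null_content_dominatesP.
set r := Radon_Nikodym (charge_of_finite_measure rho) mu.
have rfin x : r x \is a fin_num by apply: Radon_Nikodym_fin_num.
have ir : mu.-integrable setT r by apply: Radon_Nikodym_integrable.
have [w_ [iw _ cw]] := approximation_sfun_integrable measurableT ir.
have [_ /cvgr0Pnorm_le /(_ _ e0)[N _ /(_ N (leqnn N)) /= hN]] :
  (\forall n \near \oo, (\int[mu]_z `|r z - (w_ n z)%:E|)%E \is a fin_num) /\
  fine \o (fun n => \int[mu]_z `|r z - (w_ n z)%:E|)%E @ \oo --> (0 : R).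
  by apply/fine_cvgP.
have bw : bounded_measurable (w_ N).
  split; first exact: measurable_funPT.
  have [C [_ hC]] := simple_bounded (w_ N).
  by exists (C + 1) => x; apply: hC => //; rewrite ltrDl.
exists (w_ N) => // f bf f1.
set s := fun x => fine (r x).
have rs x : r x = (s x)%:E by rewrite /s fineK.
have is_ : mu.-integrable setT (EFin \o s).
  by apply: eq_integrable ir => // x _; rewrite /= -rs.
have ms : measurable_fun setT s by apply/measurable_EFinP; exact: (measurable_int mu is_).
have ifs : mu.-integrable setT (EFin \o (fun x => f x * s x)).
  apply: (le_integrable measurableT _ _ is_).
    by apply/measurable_EFinP; apply: measurable_funM => //; case: bf.
  by move=> x _ /=; rewrite lee_fin normrM ler_piMl.
have bfw := bmM bf bw.
have -> : \int[rho]_x f x = \int[mu]_x (f x * s x).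
  rewrite /Rintegral; congr fine.
  rewrite -(@Radon_Nikodym_change_of_variables _ _ _ rho mu rhomu)//; last first.
    exact: (bm_integrable rho bf).
  by apply: eq_integral => x _; rewrite -/r rs EFinM.
rewrite -RintegralB//; last exact: (bm_integrable mu bfw).
have isw : mu.-integrable setT (EFin \o (fun x => s x - w_ N x)).
  rewrite (_ : _ \o _ = ((EFin \o s) \- (EFin \o w_ N))%E)//.
  by apply: integrableB => //; exact: (bm_integrable mu bw).
have ifsw : mu.-integrable setT (EFin \o (fun x => f x * s x - f x * w_ N x)).
  rewrite (_ : _ \o _ = ((EFin \o (fun x => f x * s x)%R) \-
                        (EFin \o (fun x => f x * w_ N x)%R))%E)//.
  by apply: integrableB => //; exact: (bm_integrable mu bfw).
apply: (le_trans (le_normr_Rintegral _ ifsw)) => //.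
apply: le_trans (le_trans (ler_norm _) hN).
rewrite (_ : fine _ = \int[mu]_x `|s x - w_ N x|); last first.
  by rewrite /Rintegral; congr fine; apply: eq_integral => x _; rewrite rs.
apply: le_Rintegral => //.
- by have := integrable_norm ifsw.
- by have := integrable_norm isw.
- by move=> x _; rewrite -mulrBr normrM ler_piMl.
Qed.

End DensityApprox.

Section AsymptoticallyInvariant.
Context d (X : measurableType d) (R : realType) (mu : probability X R) (T : X -> X).
Hypothesis mp : measure_preserving mu T.
Hypothesis erg : ergodic mu T.
Variable F : nat -> X -> R.
Hypothesis bF : forall l, bounded_measurable (F l).
Hypothesis F1 : forall l x, `|F l x| <= 1.
Hypothesis F_inv : \int[mu]_x `|F l (T x) - F l x| @[l --> \oo] --> (0 : R).

(** Invariance gives [int F (w o T^n) = int (F o T) (w o T^(n+1))]; replacing [F o T] by [F] costs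
    at most [C int |F o T - F|] for each of the [n] steps. *)
Lemma asym_inv_iter l w (C : R) n : bounded_measurable w -> (forall x, `|w x| <= C) ->
  `|\int[mu]_x (F l x * w (iter n T x)) - \int[mu]_x (F l x * w x)| <=
  n%:R * (C * \int[mu]_x `|F l (T x) - F l x|).
Proof.
move=> bw wC; have bFT := bm_comp mp.1 (bF l).
have bwn k : bounded_measurable (fun x => w (iter k T x)).
  exact: (bm_comp (measurable_iterT mp k) bw).
elim: n => [|n ih]; first by rewrite mul0r subrr normr0.
have : `|\int[mu]_x (F l x * w (iter n.+1 T x)) -
         \int[mu]_x (F l x * w (iter n T x))| <=
       C * \int[mu]_x `|F l (T x) - F l x|.
  rewrite -(Rint_comp_preserving mp (bmM (bF l) (bwn n))).
  under [X in _ - X]eq_Rintegral => x _ do rewrite -iterSr.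
  rewrite -RintZ; last by apply: bm_norm; exact: bmB.
  apply: Rint_dist.
  - exact: bmM.
  - exact: bmM (bwn n.+1).
  - by apply: bmZ; apply: bm_norm; exact: bmB.
  - by move=> x; rewrite -mulrBl normrM mulrC distrC ler_pM.
move: ih; rewrite -natr1 mulrDl mul1r => ih h.
by rewrite [leRHS]addrC; apply: le_trans (lerD h ih); exact: ler_distD.
Qed.

(** Replace [w] by its time average [a], at cost [n C D] with [D] the invariance defect of [F l],
    then [a] by the mean [m], at cost [int |a - m|]. Since [n] is chosen before [l], the first cost
    vanishes in the limit. *)
Lemma asym_inv_decorrelate w : bounded_measurable w ->
  \int[mu]_x (F l x * w x) - (\int[mu]_x w x) * \int[mu]_x F l x
    @[l --> \oo] --> (0 : R).
Proof.
move=> bw; have [_ [C wC]] := bw.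
have C0 : 0 <= C by rewrite (le_trans _ (wC point)).
set m := \int[mu]_x w x.
apply/cvgr0Pnorm_le => e e0; have e2 : 0 < e / 2 by lra.
have [n n0 hn] := mean_ergodic mp erg bw e2.
have n0R : 0 < n%:R :> R by rewrite ltr0n.
have d0 : 0 < e / 2 / (n%:R * (C + 1)) by rewrite divr_gt0// mulr_gt0//; lra.
have /cvgr0Pnorm_le/(_ _ d0) := F_inv; apply: filterS => l.
set D := \int[mu]_x _ => hD.
have D0 : 0 <= D by apply: Rintegral_ge0.
rewrite ger0_norm// in hD.
set a := fun x => n%:R^-1 * birkhoff_sum T w n x.
have ba : bounded_measurable a by apply: bmZ; exact: (bm_birkhoff_sum mp).
have h1 : `|\int[mu]_x (F l x * a x) - \int[mu]_x (F l x * w x)| <= n%:R * (C * D).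
  have -> : \int[mu]_x (F l x * a x) =
      n%:R^-1 * \sum_(i < n) \int[mu]_x (F l x * w (iter i T x)).
    rewrite -Rint_sum; last first.
      by move=> i _; apply: bmM => //; exact: (bm_comp (measurable_iterT mp i) bw).
    rewrite -RintZ; last first.
      apply: bm_sum => i _; apply: bmM => //.
      exact: (bm_comp (measurable_iterT mp i) bw).
    apply: eq_Rintegral => x _.
    by rewrite /a /birkhoff_sum mulrCA mulr_sumr.
  have -> : \int[mu]_x (F l x * w x) =
      n%:R^-1 * \sum_(i < n) \int[mu]_x (F l x * w x).
    by rewrite sumr_const card_ord -[X in _ = _ * X]mulr_natl mulKf// gt_eqF.
  rewrite -mulrBr -sumrB normrM gtr0_norm ?invr_gt0// ler_pdivrMl//.
  apply: (le_trans (ler_norm_sum _ _ _)).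
  apply: (@le_trans _ _ (\sum_(i < n) n%:R * (C * D))); last first.
    by rewrite sumr_const card_ord -[X in X <= _]mulr_natl.
  apply: ler_sum => i _; apply: (le_trans (asym_inv_iter l i bw wC)).
  by apply: ler_wpM2r; [rewrite mulr_ge0|rewrite ler_nat ltnW].
have h2 : `|\int[mu]_x (F l x * a x) - \int[mu]_x (m * F l x)| <=
    \int[mu]_x `|a x - m|.
  apply: Rint_dist; [exact: bmM|exact: bmZ|by apply: bm_norm; apply: bmB => //; exact: bm_cst|].
  by move=> x; rewrite (mulrC m) -mulrBr normrM ler_piMl.
rewrite RintZ// in h2.
have h3 : n%:R * (C * D) <= e / 2.
  move: hD; rewrite ler_pdivlMr ?mulr_gt0//; last by lra.
  apply: le_trans; rewrite mulrA mulrC; apply: ler_wpM2l => //.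
  by apply: ler_wpM2l; lra.
have := hn; rewrite -/m -/a => hn'.
have -> : e = e / 2 + e / 2 by lra.
apply: (le_trans (ler_distD (\int[mu]_x (F l x * a x)) _ _)); apply: lerD.
  by rewrite distrC (le_trans h1).
by rewrite (le_trans h2).
Qed.

Lemma asym_inv_cvg (rho : probability X R) :
  (forall B, measurable B -> mu B = 0%E -> rho B = 0%E) ->
  \int[rho]_x F l x - \int[mu]_x F l x @[l --> \oo] --> (0 : R).
Proof.
move=> ac; apply/cvgr0Pnorm_le => e e0; have e3 : 0 < e / 3 by lra.
have [w bw hw] := density_approx ac e3.
have /cvgr0Pnorm_le/(_ _ e3) := asym_inv_decorrelate bw; apply: filterS => l h.
have h1 := hw _ (bF l) (F1 l).
(* [w] is only an approximate density; testing the approximation on the constant [1] bounds the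
   defect of its total mass. *)
have : `|1 - \int[mu]_x w x| <= e / 3.
  have := hw (fun=> 1) (bm_cst _ _); rewrite Rint_cst.
  under [X in _ - X]eq_Rintegral => x _ do rewrite mul1r.
  by apply => x; rewrite normr1.
set m := \int[mu]_x w x in h * => h2.
have h3 : `|\int[mu]_x F l x| <= 1.
  rewrite -[X in `|X|]subr0 -[X in _ - X](Rint_cst mu).
  by apply: Rint_dist_cst => //; [exact: bm_cst|move=> x; rewrite subr0].
set a := \int[mu]_x F l x in h h3 *.
have h4 : `|m * a - a| <= e / 3.
  rewrite -{2}[a]mul1r -mulrBl normrM distrC -[leRHS]mulr1.
  by apply: ler_pM.
have -> : e = e / 3 + (e / 3 + e / 3) by lra.
apply: (le_trans (ler_distD (\int[mu]_x (F l x * w x)) _ _)); apply: lerD => //.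
by apply: (le_trans (ler_distD (m * a) _ _)); apply: lerD.
Qed.

End AsymptoticallyInvariant.

(** * Total variation and compact families of measures *)

(** Elements of [inP] are bare set functions, constrained only on measurable sets; integration needs
    a genuine probability agreeing with them there. *)
Definition represents d (X : measurableType d) (R : realType)
  (P : probability X R) (nu : set X -> \bar R) :=
  forall B, measurable B -> P B = nu B.

Section TotalVariation.
Context d (X : measurableType d) (R : realType).
Implicit Types (mu : {measure set X -> \bar R}) (nu : set X -> \bar R)
  (P Q : probability X R).

Lemma inP_represents mu nu : inP mu nu -> exists P, represents P nu.
Proof.
move=> [nu0 nuge nusa nu1 _].
(* A measure must be nonnegative on every set, whereas [inP] says nothing off the measurable ones;
   hence the value [0] there. *)
pose f (B : set X) : \bar R := if `[< measurable B >] then nu B else 0%E.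
have fE B : measurable B -> f B = nu B by move=> mB; rewrite /f asboolT.
have f0 : f set0 = 0%E by rewrite fE.
have fge B : (0 <= f B)%E by rewrite /f; case: asboolP => // mB; exact: nuge.
have fsa : semi_sigma_additive f.
  move=> F mF tF mUF; rewrite fE//.
  rewrite (_ : (fun n => _) = (fun n => \sum_(0 <= i < n) nu (F i))%E).
    exact: nusa.
  by apply/funext => n; apply: eq_bigr => i _; rewrite fE.
have f1 : f setT = 1%E by rewrite fE.
pose M : {measure set X -> \bar R} := HB.pack f (isMeasure.Build _ _ _ f f0 fge fsa).
pose P : probability X R := HB.pack f (isMeasure.Build _ _ _ f f0 fge fsa)
  (Measure_isProbability.Build _ _ _ M f1).
by exists P.
Qed.

(** Each layer contributes an error at most [e], and [layer_mean] averages these errors. *)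
Lemma Rint_tv P Q (f : X -> R) (e : R) : bounded_measurable f ->
  (forall x, 0 <= f x <= 1) ->
  (forall B, measurable B -> `|fine (P B) - fine (Q B)| <= e) ->
  `|\int[P]_x f x - \int[Q]_x f x| <= e.
Proof.
move=> bf f01 PQ; apply/ler_addgt0Pr => c c0.
have c2 : 0 <= 2 / c by rewrite divr_ge0// ltW.
set N := (Num.bound (2 / c)).+1.
have N0 : 0 < N%:R :> R by rewrite ltr0n.
have hN : N%:R^-1 <= c / 2.
  have : 2 / c <= N%:R by rewrite (le_trans (ltW (archi_boundP c2)))// ler_nat.
  by move=> h; rewrite -[c / 2]invrK invf_div lef_pV2// posrE divr_gt0.
have bL := bm_layer_mean bf N.
have hL (P' : probability X R) :
    `|\int[P']_x f x - \int[P']_x layer_mean f N x| <= c / 2.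
  apply: Rint_dist_cst => // x; apply: le_trans hN; exact: layer_mean_dist.
have EL (P' : probability X R) : \int[P']_x layer_mean f N x =
    N%:R^-1 * \sum_(k < N) fine (P' (layer f N k)).
  have mL k := measurable_layer bf N k.
  rewrite RintZ; last by apply: bm_sum => i _; exact: bm_indic.
  rewrite Rint_sum; last by move=> i _; exact: bm_indic.
  by congr (_ * _); apply: eq_bigr => i _; rewrite Rint_indic.
have hPQ : `|\int[P]_x layer_mean f N x - \int[Q]_x layer_mean f N x| <= e.
  rewrite !EL -mulrBr -sumrB normrM gtr0_norm ?invr_gt0// ler_pdivrMl//.
  apply: (le_trans (ler_norm_sum _ _ _)).
  apply: (@le_trans _ _ (\sum_(k < N) e)).
    by apply: ler_sum => k _; apply: PQ; exact: measurable_layer.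
  by rewrite sumr_const card_ord -[X in X <= _]mulr_natl.
have := hL P; have := hL Q; move: hPQ; rewrite !ler_norml => /andP[? ?] /andP[? ?] /andP[? ?].
by apply/andP; split; lra.
Qed.

Lemma dP_lt_fine nu nu' P Q (e : R) : represents P nu -> represents Q nu' ->
  (dP nu nu' < e%:E)%E ->
  forall B, measurable B -> `|fine (P B) - fine (Q B)| <= e.
Proof.
move=> Pnu Qnu h B mB; rewrite -lee_fin; apply: le_trans (ltW h).
rewrite /dP; set s := ereal_sup _.
have hs : (`|nu B - nu' B| <= s)%E by apply: ereal_sup_ubound; exists B.
have s0 : (0 <= s)%E by apply: le_trans hs.
apply: (@le_trans _ _ s).
  by rewrite -Pnu// -Qnu// -probability_fine// -(@probability_fine _ _ _ Q)// in hs.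
by rewrite -[leLHS]mul1e lee_wpmul2r// lee_fin ler1n.
Qed.

Section Compact.
Variables (mu : probability X R) (T : X -> X).
Hypothesis mp : measure_preserving mu T.
Hypothesis erg : ergodic mu T.
Variable F : nat -> X -> R.
Hypothesis bF : forall l, bounded_measurable (F l).
Hypothesis F01 : forall l x, 0 <= F l x <= 1.
Hypothesis F_inv : \int[mu]_x `|F l (T x) - F l x| @[l --> \oo] --> (0 : R).

(** [U n] collects the measures whose error stays below [e] with some slack for all [l >= n]. The
    slack [e - c] makes [U n] open, since a ball of half that radius fits inside; [asym_inv_cvg]
    makes the [U n] cover [K]; the largest index of a finite subcover is a uniform threshold. *)
Lemma dP_compact_cvg K (e : R) : dP_compact mu K -> 0 < e ->
  exists n, forall l nu P, (n <= l)%N -> K nu -> represents P nu ->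
    `|\int[P]_x F l x - \int[mu]_x F l x| <= e.
Proof.
move=> [KP Kc] e0.
pose U n := [set nu | inP mu nu /\ exists2 c : R, c < e &
  forall P l, represents P nu -> (n <= l)%N ->
    `|\int[P]_x F l x - \int[mu]_x F l x| <= c].
have F1 l x : `|F l x| <= 1 by have /andP[h0 h1] := F01 l x; rewrite ger0_norm.
have Uopen n : dP_open mu (U n).
  split=> [nu []//|nu [nuP [c ce hc]]].
  exists ((e - c) / 2); split; first by lra.
  move=> nu' nu'P hd; split=> //; exists (c + (e - c) / 2); first by lra.
  move=> P' l P'nu' nl; have [P Pnu] := inP_represents nuP.
  have h := Rint_tv (bF l) (F01 l) (dP_lt_fine Pnu P'nu' hd).
  have h' := hc P l Pnu nl.
  rewrite [leRHS]addrC; apply: le_trans (ler_distD (\int[P]_x F l x) _ _) _.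
  by apply: lerD => //; rewrite distrC.
have Ucov : K `<=` \bigcup_i U i.
  move=> nu /[dup] Knu /KP nuP; have [P Pnu] := inP_represents nuP.
  have ac B : measurable B -> mu B = 0%E -> P B = 0%E.
    by move=> mB muB; rewrite Pnu//; case: nuP => _ _ _ _; exact.
  have e2 : 0 < e / 2 by lra.
  have /cvgr0Pnorm_le/(_ _ e2)[n _ hn] := asym_inv_cvg mp erg bF F1 F_inv ac.
  exists n => //; split => //; exists (e / 2); first by lra.
  move=> P' l P'nu nl.
  rewrite (@eq_Rint_measure _ _ _ P' P); first exact: hn.
  by move=> B mB; rewrite P'nu// Pnu.
have [I [/finite_seqP[s ->] Icov]] := Kc _ _ Uopen Ucov.
exists (\max_(i <- s) i)%N => l nu P sl Knu Pnu.
have [i /= si [_ [c ce hc]]] := Icov _ Knu.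
apply: le_trans (ltW ce); apply: hc => //; apply: leq_trans sl.
exact: leq_bigmax_seq.
Qed.

End Compact.
End TotalVariation.

(** * Hitting times and return monomials *)

Section HittingTimes.
Context d (X : measurableType d) (R : realType) (T : X -> X) (A : set X).
Local Notation hit := (@hit_time d X R T A).
Local Notation ind := (@induced_map d X R T A).

(** A discrete stand-in for the infimum in [hit_time]. Together with [never_hit] it cuts the space
    into countably many pieces on which the hitting time is constant and the induced map is an
    iterate of [T]. *)
Definition first_hit (n : nat) (x : X) :=
  [/\ (0 < n)%N, A (iter n T x) & forall m, (0 < m < n)%N -> ~ A (iter m T x)].

Definition never_hit (x : X) := forall m, (0 < m)%N -> ~ A (iter m T x).

Lemma first_hit_or_never x : (exists n, first_hit n x) \/ never_hit x.
Proof.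
have [[n n0 An]|h] := pselect (exists2 n, (0 < n)%N & A (iter n T x)); last first.
  by right => m m0 Am; apply: h; exists m.
left; have ex : exists n, (0 < n)%N && `[< A (iter n T x) >].
  by exists n; rewrite n0; exact/asboolP.
case: (ex_minnP ex) => m /andP[m0 /asboolP Am] hm; exists m; split => // k /andP[k0 km] Ak.
by have := hm k; rewrite k0 asboolT// => /(_ isT); rewrite leqNgt km.
Qed.

Lemma hit_time_first n x : first_hit n x -> hit x = n%:R%:E.
Proof.
move=> [n0 An hn]; apply/eqP; rewrite eq_le; apply/andP; split.
  by apply: ereal_inf_lbound; exists n.
apply: le_ereal_inf_tmp => _ [m /= [m0 Am] <-]; rewrite lee_fin ler_nat leqNgt.
by apply/negP => mn; apply: (hn m) => //; rewrite m0.
Qed.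

Lemma hit_time_never x : never_hit x -> hit x = +oo%E.
Proof.
move=> h; rewrite /hit_time (_ : [set _ | _ in _] = set0) ?ereal_inf0//.
by apply/seteqP; split=> // _ [m /= [m0 Am] _]; exact: (h m).
Qed.

Lemma hit_time_ge0 x : (0 <= hit x)%E.
Proof.
have [[n /hit_time_first ->]|/hit_time_never ->] := first_hit_or_never x => //.
Qed.

Lemma induced_map_first n x : first_hit n x -> ind x = iter n T x.
Proof.
move=> fn; rewrite /induced_map; case: xgetP => [y -> [m [hm ->]]|/(_ (iter n T x))].
  move: hm; rewrite (hit_time_first fn) => -[] /eqP.
  by rewrite eqr_nat => /eqP ->.
by case; exists n; split=> //; exact: hit_time_first.
Qed.

Lemma induced_map_never x : never_hit x -> ind x = x.
Proof.
move=> nx; rewrite /induced_map; case: xgetP => // y -> [m [hm _]].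
by move: hm; rewrite (hit_time_never nx).
Qed.

Lemma first_hit1 x : A (T x) -> first_hit 1 x.
Proof. by move=> AT; split => // -[|m]. Qed.

Lemma first_hitS n x : ~ A (T x) -> first_hit n (T x) -> first_hit n.+1 x.
Proof.
move=> nA [n0 An hn]; split=> //; first by rewrite iterSr.
case=> [//|[//|m]] /andP[_ mn]; rewrite iterSr; apply: hn.
exact: mn.
Qed.

Lemma never_hitS x : ~ A (T x) -> never_hit (T x) -> never_hit x.
Proof. by move=> nA h [//|[//|m]] _; rewrite iterSr; exact: h. Qed.

Lemma lt_hit_timeP n x : (n%:R%:E < hit x)%E <->
  forall m, (0 < m <= n)%N -> ~ A (iter m T x).
Proof.
have [[k /[dup] fk /hit_time_first ->]|/[dup] nx /hit_time_never ->] := first_hit_or_never x.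
  rewrite lte_fin ltr_nat; case: fk => k0 Ak hk; split => [nk m /andP[m0 mn]|h].
    by apply: hk; rewrite m0 (leq_ltn_trans mn).
  by rewrite ltnNge; apply/negP => kn; apply: (h k) => //; rewrite k0.
by rewrite ltry; split=> // _ m /andP[m0 _]; exact: nx.
Qed.

Hypothesis mT : measurable_fun setT T.
Hypothesis mA : measurable A.

Let mA_ n : measurable [set x | A (iter n T x)].
Proof.
have mTn : measurable_fun setT (iter n T).
  by elim: n => [|n ih]; [exact: measurable_id|exact: (measurableT_comp mT ih)].
by have := mTn measurableT A mA; rewrite setTI.
Qed.

Lemma measurable_no_hit (p : pred nat) :
  measurable [set x | forall m, p m -> ~ A (iter m T x)].
Proof.
rewrite (_ : [set x | _] = \bigcap_(m in p) ~` [set x | A (iter m T x)]).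
  by apply: bigcap_measurableType => // m _; exact: measurableC.
by apply/seteqP; split => x h m pm; exact: h.
Qed.

(* Index [0] is the set of points that never enter [A]. *)
Definition hit_part (n : nat) : set X :=
  if n is 0 then never_hit else first_hit n.

Lemma measurable_hit_part n : measurable (hit_part n).
Proof.
case: n => [|n]; first exact: (measurable_no_hit (fun m => 0 < m)%N).
have -> : hit_part n.+1 = [set x | A (iter n.+1 T x)] `&`
  [set x | forall m, (0 < m < n.+1)%N -> ~ A (iter m T x)].
  by apply/seteqP; split => x; [case|move=> []; split].
apply: measurableI => //; exact: (measurable_no_hit (fun m => 0 < m < n.+1)%N).
Qed.

Lemma bigcup_hit_part : \bigcup_n hit_part n = setT.
Proof.
apply/seteqP; split=> // x _; have [[[|n] fn]|nx] := first_hit_or_never x.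
- by case: fn.
- by exists n.+1.
- by exists 0%N.
Qed.

Lemma measurable_fun_hit_part d' (Y : measurableType d') (f : X -> Y)
    (g : nat -> X -> Y) :
  (forall n, measurable_fun setT (g n)) ->
  (forall n x, hit_part n x -> f x = g n x) -> measurable_fun setT f.
Proof.
move=> mg fg; rewrite -bigcup_hit_part.
apply/measurable_fun_bigcup => [n|n]; first exact: measurable_hit_part.
apply: (@eq_measurable_fun _ _ _ _ _ (g n)).
  by move=> x; rewrite inE => /fg.
exact: measurable_funTS.
Qed.

Lemma measurable_induced_map : measurable_fun setT ind.
Proof.
apply: (@measurable_fun_hit_part _ _ _ (fun n => iter n T)).
  by elim=> [|n ih]; [exact: measurable_id|exact: (measurableT_comp mT ih)].
by move=> [|n] x /=; [exact: induced_map_never|exact: induced_map_first].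
Qed.

Lemma measurable_hit_time : measurable_fun setT hit.
Proof.
apply: (@measurable_fun_hit_part _ _ _ (fun n => cst (if n is 0 then +oo%E else n%:R%:E))).
  by move=> n; exact: measurable_cst.
by move=> [|n] x /=; [exact: hit_time_never|exact: hit_time_first].
Qed.

Lemma measurable_Ttau (tau : X -> nat) : measurable_fun setT tau ->
  measurable_fun setT (Ttau T tau).
Proof.
move=> mtau; have -> : setT = \bigcup_n tau @^-1` [set n].
  by apply/seteqP; split=> // x _; exists (tau x).
have mt n : measurable (tau @^-1` [set n]).
  by have := mtau measurableT [set n] I; rewrite setTI.
apply/measurable_fun_bigcup => // n.
apply: (@eq_measurable_fun _ _ _ _ _ (iter n T)).
  by move=> x; rewrite inE /Ttau/= => ->.
apply: measurable_funTS.
by elim: n => [|n ih]; [exact: measurable_id|exact: (measurableT_comp mT ih)].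
Qed.

End HittingTimes.

(** * Laplace monomials of the return process *)

Section ReturnLaplace.
Context d (X : measurableType d) (R : realType) (mu : probability X R)
  (T : X -> X) (A : set X).
Hypothesis mp : measure_preserving mu T.
Hypothesis mA : measurable A.
Hypothesis A0 : (0 < mu A)%E.
Local Notation hit := (@hit_time d X R T A).
Local Notation ind := (@induced_map d X R T A).
Local Notation h := (fine (mu A)).

Definition expN_hit (x : X) : R := expN (mu A * hit x)%E.

(* [ks] lists the exponents of [e^{-mu(A) phi_A}, e^{-mu(A) phi_A o T_A}, ...]. *)
Fixpoint return_monomial (ks : seq nat) (x : X) : R :=
  if ks is k :: ks' then expN_hit x ^+ k * return_monomial ks' (ind x) else 1.

Lemma mu_fine_gt0 : 0 < h.
Proof. by rewrite fine_gt0// A0/= ltey_eq fin_num_measure. Qed.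

Lemma expN_hit_first n x : first_hit T A n x -> expN_hit x = expR (- (h * n%:R)).
Proof.
by move=> fn; rewrite /expN_hit (hit_time_first R fn) -probability_fine.
Qed.

Lemma expN_hit_never x : never_hit T A x -> expN_hit x = 0.
Proof.
move=> nx; rewrite /expN_hit (hit_time_never R nx) -probability_fine//.
by rewrite gt0_muley// lte_fin mu_fine_gt0.
Qed.

Lemma expN_hit_in x : A (T x) -> expN_hit x = expR (- h).
Proof. by move=> /first_hit1/expN_hit_first ->; rewrite mulr1. Qed.

Lemma expN_hit_notin x : ~ A (T x) -> expN_hit x = expR (- h) * expN_hit (T x).
Proof.
move=> nA; have [[n /[dup] fn /expN_hit_first ->]|/[dup] nx /expN_hit_never ->] :=
  first_hit_or_never T A (T x).
  rewrite (expN_hit_first (first_hitS nA fn)) -expRD.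
  by congr expR; rewrite -natr1; ring.
by rewrite mulr0 expN_hit_never//; exact: never_hitS.
Qed.

Lemma expN_hit_01 x : 0 <= expN_hit x <= 1.
Proof.
have [[n /expN_hit_first ->]|/expN_hit_never ->] := first_hit_or_never T A x.
  by rewrite expR_ge0 -expR0 ler_expR oppr_le0 mulr_ge0// ltW// mu_fine_gt0.
by rewrite lexx ler01.
Qed.

Lemma bm_expN_hit : bounded_measurable expN_hit.
Proof.
split; last by exists 1 => x; have /andP[? ?] := expN_hit_01 x; rewrite ger0_norm.
apply: (@measurable_fun_hit_part _ _ T A mp.1 mA _ _ _
  (fun n => cst (if n is 0 then 0 else expR (- (h * n%:R))))).
  by move=> n; exact: measurable_cst.
by move=> [|n] x /=; [exact: expN_hit_never|exact: expN_hit_first].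
Qed.

Lemma bm_return_monomial ks : bounded_measurable (return_monomial ks).
Proof.
elim: ks => [|k ks ih] /=; first exact: bm_cst.
apply: bmM; first exact: bmX bm_expN_hit.
by apply: bm_comp ih; exact: (measurable_induced_map R mp.1 mA).
Qed.

Lemma return_monomial_01 ks x : 0 <= return_monomial ks x <= 1.
Proof.
elim: ks x => [|k ks ih] x /=; first by rewrite ler01 lexx.
have /andP[u0 u1] := expN_hit_01 x; have /andP[v0 v1] := ih (ind x).
by rewrite mulr_ge0 ?exprn_ge0//= mulr_ile1 ?exprn_ge0// exprn_ile1.
Qed.

(** Here the hitting time is [1] and the induced map is [T], so the first factor becomes a constant
    and the shorter monomial appears. *)
Lemma return_monomial_in k ks x : A (T x) ->
  return_monomial (k :: ks) x = expR (- h) ^+ k * return_monomial ks (T x).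
Proof.
move=> AT; rewrite /= expN_hit_in//.
by rewrite (induced_map_first R (first_hit1 AT)).
Qed.

(** The induced map fixes both points and every factor is a power of [0]. The common value need not
    be [0], because zero exponents give [0^0 = 1]. *)
Lemma return_monomial_never ks x : never_hit T A (T x) -> ~ A (T x) ->
  return_monomial ks x = return_monomial ks (T x).
Proof.
move=> nTx nA; have nx := never_hitS nA nTx.
elim: ks => [//|k ks ih] /=.
by rewrite !expN_hit_never// !(@induced_map_never _ _ R) ?ih.
Qed.

(** Outside [T^-1 A] the points [x] and [T x] first enter [A] at the same place, so all later
    factors agree and only the first hitting time drops by one. *)
Lemma return_monomial_notin k ks x : ~ A (T x) ->
  return_monomial (k :: ks) x = expR (- h) ^+ k * return_monomial (k :: ks) (T x).
Proof.
move=> nA; rewrite /= expN_hit_notin// exprMn mulrA; congr (_ * _).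
have [[n fn]|nx] := first_hit_or_never T A (T x).
  rewrite (induced_map_first R (first_hitS nA fn)) (induced_map_first R fn).
  by rewrite iterSr.
rewrite (@induced_map_never _ _ R _ _ x); last exact: never_hitS.
by rewrite (@induced_map_never _ _ R _ _ (T x))// return_monomial_never.
Qed.

Lemma return_monomial_step k ks x : ~ A (T x) ->
  `|return_monomial (k :: ks) (T x) - return_monomial (k :: ks) x| <= k%:R * h.
Proof.
move=> nA; rewrite (return_monomial_notin _ _ nA).
set v := return_monomial _ _; have /andP[v0 v1] : 0 <= v <= 1 by exact: return_monomial_01.
have h0 := ltW mu_fine_gt0.
have a1 : expR (- h) ^+ k <= 1.
  by rewrite exprn_ile1 ?expR_ge0// -expR0 ler_expR oppr_le0.
rewrite -{1}[v]mul1r -mulrBl normrM ger0_norm ?subr_ge0// (ger0_norm v0).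
apply: (@le_trans _ _ (1 - expR (- h) ^+ k)); first by rewrite ler_piMr// subr_ge0.
rewrite -expRM_natl; have := expR_ge1Dx (k%:R * - h); lra.
Qed.

(** Before the hitting time every step avoids [A] and costs at most [k h]; this is where the
    requirement that the delay precede the hitting time enters. *)
Lemma return_monomial_iter k ks n x : (n%:R%:E < hit x)%E ->
  `|return_monomial (k :: ks) (iter n T x) - return_monomial (k :: ks) x| <=
  k%:R * (h * n%:R).
Proof.
move=> /lt_hit_timeP; elim: n => [|n ih] hn; first by rewrite subrr normr0 !mulr0.
have nA : ~ A (T (iter n T x)) by apply: (hn n.+1); rewrite leqnn.
have ih' := ih (fun m => _); move: ih'.
have hn' m : (0 < m <= n)%N -> ~ A (iter m T x).
  by move=> /andP[m0 mn]; apply: hn; rewrite m0 leqW.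
move=> /(_ hn') {}ih.
rewrite -natr1 mulrDr mulr1 mulrDr [leRHS]addrC.
apply: le_trans (ler_distD (return_monomial (k :: ks) (iter n T x)) _ _) _.
by apply: lerD => //; exact: return_monomial_step.
Qed.

(** A step costs [k h] off [T^-1 A]; on [T^-1 A], of measure [h], the trivial bound [1] is used. *)
Lemma return_monomial_asym_inv k ks :
  \int[mu]_x `|return_monomial (k :: ks) (T x) - return_monomial (k :: ks) x| <=
  (k%:R + 1) * h.
Proof.
have bF := bm_return_monomial (k :: ks); have bFT := bm_comp mp.1 bF.
have bA := @bm_indic _ _ R _ mA.
have -> : (k%:R + 1) * h = \int[mu]_x (k%:R * h + \1_A (T x)).
  rewrite RintD; [|exact: bm_cst|exact: bm_comp mp.1 bA].
  by rewrite Rint_cst (Rint_comp_preserving mp bA) Rint_indic// mulrDl mul1r.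
apply: le_Rint.
- by apply: bm_norm; exact: bmB.
- by apply: bmD; [exact: bm_cst|exact: bm_comp mp.1 bA].
move=> x; rewrite indicE; have [AT|AT] := pselect (A (T x)).
  rewrite (mem_set AT) (_ : true%:R = 1)//; have /andP[F0 F1] := return_monomial_01 (k :: ks) x.
  have /andP[FT0 FT1] := return_monomial_01 (k :: ks) (T x).
  have kh0 : 0 <= k%:R * h by rewrite mulr_ge0// ltW// mu_fine_gt0.
  by rewrite ler_norml; apply/andP; split; lra.
by rewrite (memNset AT) addr0 return_monomial_step.
Qed.

(* [T]-invariance of [mu], split according to whether [T x] lies in [A]. *)
Lemma return_monomial_identity k ks :
  (expR h ^+ k - 1) * \int[mu]_x return_monomial (k :: ks) x =
  \int[mu]_x (\1_A x * return_monomial ks x) -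
  \int[mu]_x (\1_A x * return_monomial (k :: ks) x).
Proof.
set F := return_monomial (k :: ks); set G := return_monomial ks.
have bF : bounded_measurable F := bm_return_monomial (k :: ks).
have bG : bounded_measurable G := bm_return_monomial ks.
have bA := @bm_indic _ _ R _ mA.
have bAF := bmM bA bF; have bAG := bmM bA bG.
have E : \int[mu]_x F x = expR (- h) ^+ k * (\int[mu]_x (\1_A x * G x) +
    (\int[mu]_x F x - \int[mu]_x (\1_A x * F x))).
  rewrite -[in RHS]RintB// -RintD//; last exact: bmB.
  rewrite -RintZ; last by apply: bmD => //; exact: bmB.
  (* Composed with [T], this function is [F]: its two summands are the cases [T x] in [A] and [T x]
     outside [A]. *)
  have bH : bounded_measurable (fun x => expR (- h) ^+ k * (\1_A x * G x + (F x - \1_A x * F x))).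
    by apply: bmZ; apply: bmD => //; exact: bmB.
  rewrite -(Rint_comp_preserving mp bH).
  apply: eq_Rintegral => x _; rewrite indicE; have [AT|AT] := pselect (A (T x)).
    by rewrite (mem_set AT) !mul1r subrr addr0 /F return_monomial_in.
  by rewrite (memNset AT) !mul0r subr0 add0r /F return_monomial_notin.
have {}E : expR h ^+ k * \int[mu]_x F x = \int[mu]_x (\1_A x * G x) +
    (\int[mu]_x F x - \int[mu]_x (\1_A x * F x)).
  by rewrite {1}E mulrA -exprMn -expRD subrr expR0 expr1n mul1r.
rewrite mulrBl mul1r E; ring.
Qed.

End ReturnLaplace.

(** * Hitting versus return moments along rare events *)

Section Conditional.
Context d (X : measurableType d) (R : realType) (mu : probability X R)
  (A : set X) (mA : measurable A).
Hypothesis A0 : (0 < mu A)%E.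

Lemma condmE B : condm mu mA B = (mu (B `&` A) * (fine (mu A))^-1%:E)%E.
Proof.
have mE : mrestr mu mA setT = mu A by rewrite /mrestr setTI.
(* [mnormalize] returns its default [mu] when the mass is [0] or [+oo]; positivity and finiteness of
   [mu A] rule this out. *)
rewrite /condm /mnormalize ifF.
  by congr (_ * (fine _)^-1%:E)%E; exact: mE.
apply/negbTE; rewrite negb_or; apply/andP; split; apply/eqP => E.
  by move: A0; rewrite -mE (E : mrestr mu mA setT = 0%E) ltxx.
have : (mu A < +oo)%E by rewrite (le_lt_trans (probability_le1 _ _)) ?ltry.
by rewrite -mE (E : mrestr mu mA setT = +oo%E) ltxx.
Qed.

Lemma Rint_condm (f : X -> R) : bounded_measurable f ->
  (forall x, 0 <= f x <= 1) ->
  \int[condm mu mA]_x f x = (fine (mu A))^-1 * \int[mu]_x (\1_A x * f x).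
Proof.
move=> bf f01; have bA := @bm_indic _ _ R _ mA.
rewrite -RintZ; last exact: bmM.
have mid : measurable_fun setT (@id X) by exact: measurable_id.
have := @Rint_weighted_eq _ _ _ X X X R (condm mu mA) mu id id (fun=> 1)
  (fun x => (fine (mu A))^-1 * \1_A x) mid mid
  (bm_integrable_cst _ _)
  (bm_integrable _ (bmZ _ bA)) _ f bf f01 => h.
transitivity (\int[condm mu mA]_x (f x * 1)).
  by apply: eq_Rintegral => x _; rewrite mulr1.
rewrite h.
  by apply: eq_Rintegral => x _; rewrite mulrC mulrA.
move=> B mB; have bB := @bm_indic _ _ R _ mB.
under eq_Rintegral => x _ do rewrite mulr1.
rewrite Rint_indic// [X in fine X]condmE.
have mBA := measurableI _ _ mB mA.
rewrite -(probability_fine mu mBA)/=.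
under [RHS]eq_Rintegral => x _ do rewrite mulrCA.
rewrite RintZ; last exact: bmM.
rewrite mulrC; congr (_ * _); rewrite -Rint_indic//.
by apply: eq_Rintegral => x _; rewrite indicI.
Qed.

End Conditional.

(** * Limits of return monomials along rare events *)

Section RareEvents.
Context d (X : measurableType d) (R : realType) (mu : probability X R)
  (T : X -> X) (A : nat -> set X) (mA : forall l, measurable (A l)).
Hypothesis mp : measure_preserving mu T.
Hypothesis erg : ergodic mu T.
Hypothesis A0 : forall l, (0 < mu (A l))%E.
Hypothesis Acvg : (mu (A l) @[l --> \oo] --> 0)%E.

Local Notation h l := (fine (mu (A l))).
Local Notation F ks l := (return_monomial mu T (A l) ks).

Lemma rare_fine : h l @[l --> \oo] --> (0 : R).
Proof. by case/fine_cvgP : Acvg. Qed.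

Lemma return_monomial_asym_inv_cvg k ks :
  \int[mu]_x `|F (k :: ks) l (T x) - F (k :: ks) l x| @[l --> \oo] --> (0 : R).
Proof.
apply: (@squeeze_cvgr _ _ _ _ (fun=> 0) (fun l => (k%:R + 1) * h l)).
- near=> l; rewrite Rintegral_ge0//=; exact: return_monomial_asym_inv.
- exact: cvg_cst.
- rewrite -[X in _ --> X](mulr0 (k%:R + 1)); apply: cvgMr; exact: rare_fine.
Unshelve. all: by end_near. Qed.

Section Delay.
Variables (nu : nat -> set X -> \bar R) (tau : nat -> X -> nat).
Hypothesis nutau : conditions123 mu T A nu tau.
Variable P : nat -> probability X R.
Hypothesis Pnu : forall l, represents (P l) (nu l).

(** The integrand is at most [k c] where the scaled delay is at most [c] and precedes the hitting
    time, and at most [1] on the two exceptional events, whose probabilities vanish by (1) and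
    (2). *)
Lemma return_monomial_delay k ks :
  \int[P l]_x F (k :: ks) l (Ttau T (tau l) x) - \int[P l]_x F (k :: ks) l x
    @[l --> \oo] --> (0 : R).
Proof.
case: nutau => mtau tau_small tau_lt _.
apply/cvgr0Pnorm_le => e e0.
(* Chosen so that [k c <= e / 3]; the [+ 1] covers [k = 0]. *)
set c := e / (3 * (k%:R + 1)).
have k0 : 0 <= k%:R :> R by [].
have c0 : 0 < c by rewrite divr_gt0//; lra.
have kc : k%:R * c <= e / 3.
  rewrite /c mulrA ler_pdivrMr; last by lra.
  rewrite -subr_ge0 (_ : _ - _ = e); [exact: ltW|by field].
pose S1 l := [set x | (c%:E < mu (A l) * ((tau l x)%:R)%:E)%E].
pose S2 l := [set x | (((tau l x)%:R)%:E < hit_time T (A l) x :> \bar R)%E].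
have mtauE l : measurable_fun setT (fun x => ((tau l x)%:R : R)%:E).
  apply/measurable_EFinP; apply: (measurableT_comp (f := fun n : nat => n%:R : R)) => //.
have mS1 l : measurable (S1 l).
  rewrite /S1 -[X in measurable X]setTI; apply: measurable_lte => //.
  by apply: measurable_funeM.
have mS2 l : measurable (S2 l).
  rewrite /S2 -[X in measurable X]setTI; apply: measurable_lte => //.
  by have := @measurable_hit_time _ _ R _ _ mp.1 (mA l).
have e3 : 0 < e / 3 by lra.
have P1 : \forall l \near \oo, fine (P l (S1 l)) <= e / 3.
  have /fine_cvgP[_ /cvgr0Pnorm_le/(_ _ e3)] := tau_small _ c0.
  apply: filterS => l; rewrite /= -/(S1 l) => hl.
  by rewrite Pnu// (le_trans (ler_norm _)).
have P2 : \forall l \near \oo, 1 - fine (P l (S2 l)) <= e / 3.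
  have /fine_cvgP[_ /cvgrPdist_le/(_ _ e3)] := tau_lt.
  apply: filterS => l; rewrite /= -/(S2 l) => hl.
  by rewrite Pnu// (le_trans (ler_norm _)).
near=> l.
have bF := bm_return_monomial mp (mA l) (A0 l) (k :: ks).
have F01 := return_monomial_01 T (mA l) (A0 l) (k :: ks).
have bFt := bm_comp (measurable_Ttau mp.1 (mtau l)) bF.
have bi B : measurable B -> bounded_measurable (\1_B : X -> R) by exact: bm_indic.
have b1 : bounded_measurable (fun x => 1 - \1_(S2 l) x : R).
  by apply: bmB; [exact: bm_cst|exact: bi].
apply: (@le_trans _ _ (\int[P l]_x (k%:R * c + (\1_(S1 l) x + (1 - \1_(S2 l) x))))).
  apply: Rint_dist => //.
    by apply: bmD; [exact: bm_cst|apply: bmD => //; exact: bi].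
  move=> x; rewrite !indicE.
  have /andP[f0 f1] := F01 x; have /andP[g0 g1] := F01 (Ttau T (tau l) x).
  have kc0 : 0 <= k%:R * c by rewrite mulr_ge0// ltW.
  have le1 : `|F (k :: ks) l (Ttau T (tau l) x) - F (k :: ks) l x| <= 1.
    by rewrite ler_norml; apply/andP; split; lra.
  have [x1|x1] := pselect (S1 l x).
    rewrite (mem_set x1); apply: (le_trans le1); rewrite (_ : true%:R = 1)//.
    have : (x \in S2 l)%:R <= 1 :> R by case: (_ \in _).
    lra.
  rewrite (memNset x1); have [x2|x2] := pselect (S2 l x); last first.
    by rewrite (memNset x2); apply: (le_trans le1); lra.
  rewrite (mem_set x2) (_ : true%:R = 1)// subrr !addr0.
  apply: (le_trans (return_monomial_iter (mA l) (A0 l) k ks x2)).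
  rewrite ler_wpM2l// -lee_fin EFinM probability_fine// leNgt.
  exact/negP.
rewrite RintD; [|exact: bm_cst|by apply: bmD => //; exact: bi].
rewrite RintD//; last exact: bi.
rewrite RintB; [|exact: bm_cst|exact: bi].
rewrite !Rint_cst !Rint_indic//.
have : fine (P l (S1 l)) <= e / 3 by near: l.
have : 1 - fine (P l (S2 l)) <= e / 3 by near: l.
lra.
Unshelve. all: by end_near. Qed.

End Delay.

Hypothesis close : forall eps : R, 0 < eps ->
  exists (nu : nat -> set X -> \bar R) (tau : nat -> X -> nat),
    (forall l, inP mu (nu l)) /\
    (forall l, dP (nu l) (condm mu (mA l)) < eps%:E)%E /\
    conditions123 mu T A nu tau.

(** A chain of three errors [e / 3]: from [mu] to the delayed measure in [K] by compactness, from
    the delayed measure back to [nu] by the delay estimate, and from [nu] to [mu_A] by total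
    variation. *)
Lemma return_hitting_close k ks :
  \int[mu]_x F (k :: ks) l x - \int[condm mu (mA l)]_x F (k :: ks) l x
    @[l --> \oo] --> (0 : R).
Proof.
apply/cvgr0Pnorm_le => e e0; have e3 : 0 < e / 3 by lra.
have [nu [tau [nuP [nuclose nutau]]]] := close e3.
have [P Pnu] := choice (fun l => inP_represents (nuP l)).
have delay := return_monomial_delay nutau Pnu k ks.
case: (nutau) => mtau _ _ [K [Kc KT]].
have [Q Qnu] := choice (fun l => inP_represents (Kc.1 _ (KT l))).
have bF l := bm_return_monomial mp (mA l) (A0 l) (k :: ks).
have F01 l := return_monomial_01 T (mA l) (A0 l) (k :: ks).
have [n hn] := dP_compact_cvg mp erg bF F01 (return_monomial_asym_inv_cvg k ks) Kc e3.
near=> l.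
have QP : \int[Q l]_x F (k :: ks) l x = \int[P l]_x F (k :: ks) l (Ttau T (tau l) x).
  have mTt := measurable_Ttau mp.1 (mtau l).
  apply: Rint_transport => // B mB; rewrite Qnu// /pushf Pnu//.
  by rewrite -[X in measurable X]setTI; exact: mTt.
have h1 : `|\int[Q l]_x F (k :: ks) l x - \int[mu]_x F (k :: ks) l x| <= e / 3.
  by apply: (hn l _ (Q l) _ (KT l) (Qnu l)); near: l; exact: nbhs_infty_ge.
have h2 : `|\int[P l]_x F (k :: ks) l (Ttau T (tau l) x) - \int[P l]_x F (k :: ks) l x| <= e / 3.
  by near: l; move/cvgr0Pnorm_le : delay; exact.
have h3 : `|\int[P l]_x F (k :: ks) l x - \int[condm mu (mA l)]_x F (k :: ks) l x| <= e / 3.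
  apply: Rint_tv => //; apply: (dP_lt_fine (Pnu l) _ (nuclose l)) => B mB //.
rewrite QP distrC in h1; have -> : e = e / 3 + (e / 3 + e / 3) by lra.
apply: le_trans (ler_distD (\int[P l]_x F (k :: ks) l (Ttau T (tau l) x)) _ _) _.
apply: lerD => //; apply: le_trans (ler_distD (\int[P l]_x F (k :: ks) l x) _ _) _.
exact: lerD.
Unshelve. all: by end_near. Qed.

(** The bound [1 + x <= exp x] at [x = k h] and [x = - k h] squeezes the quotient between [k] and
    [k / (1 - k h)]. *)
Lemma expR_quotient_cvg k : (expR (h l) ^+ k - 1) / h l @[l --> \oo] --> (k%:R : R).
Proof.
apply: (@squeeze_cvgr _ _ _ _ (fun=> k%:R) (fun l => k%:R / (1 - k%:R * h l))).
(* Once [h] is below this value, [k h < 1] and the upper bound makes sense. *)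
- have small : 0 < (k%:R + 1 : R)^-1 by rewrite invr_gt0 ltr_wpDl.
  have /cvgr0Pnorm_lt/(_ _ small) := rare_fine; apply: filterS => l.
  have hl0 := mu_fine_gt0 (mA l) (A0 l).
  rewrite gtr0_norm// -[X in _ < X]mulr1 ltr_pdivlMl ?ltr_wpDl// => kh.
  have kh1 : 0 < 1 - k%:R * h l by have := hl0; lra.
  rewrite -expRM_natl; apply/andP; split.
    by rewrite ler_pdivlMr//; have := expR_ge1Dx (k%:R * h l); lra.
  rewrite ler_pdivrMr// mulrAC ler_pdivlMr//.
  have e1 := expR_ge1Dx (- (k%:R * h l)); have e0 := expR_gt0 (k%:R * h l).
  have : expR (k%:R * h l) * (1 - k%:R * h l) <= 1.
    rewrite -[leRHS]expR0 -(subrr (k%:R * h l)) expRD ler_wpM2l// ltW//.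
  lra.
- exact: cvg_cst.
- rewrite -[X in _ --> X]divr1 -[X in _ / X](subr0 1) -(mulr0 k%:R).
  apply: cvgM; first exact: cvg_cst.
  apply: cvgV; first by rewrite mulr0 subr0 oner_neq0.
  apply: cvgB; first exact: cvg_cst.
  by apply: cvgMr; exact: rare_fine.
Qed.

(** The identity reads [c a = g - b], that is [(c + 1) a = g + (a - b)], where [c] tends to [k] and
    [a - b] to [0]. Only the [mu_A] half for the shorter monomial feeds the induction; the [mu] half
    follows along with it. *)
Lemma return_monomial_cvg ks :
  (\int[condm mu (mA l)]_x F ks l x @[l --> \oo] -->
     \prod_(k <- ks) (k%:R + 1 : R)^-1) /\
  (\int[mu]_x F ks l x @[l --> \oo] --> \prod_(k <- ks) (k%:R + 1 : R)^-1).
Proof.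
elim: ks => [|k ks [ih _]].
  rewrite big_nil; split.
    by under eq_fun => l do rewrite /= Rint_cst; exact: cvg_cst.
  by under eq_fun => l do rewrite /= Rint_cst; exact: cvg_cst.
rewrite big_cons; set L := \prod_(k <- ks) _ in ih *.
pose a l := \int[mu]_x F (k :: ks) l x.
pose b l := \int[condm mu (mA l)]_x F (k :: ks) l x.
pose g l := \int[condm mu (mA l)]_x F ks l x.
pose c l := (expR (h l) ^+ k - 1) / h l.
have k1 : k%:R + 1 != 0 :> R by rewrite natr1 pnatr_eq0.
have bF ks' l := bm_return_monomial mp (mA l) (A0 l) ks'.
have F01 ks' l := return_monomial_01 T (mA l) (A0 l) ks'.
have c1 l : c l + 1 != 0.
  have hl0 := mu_fine_gt0 (mA l) (A0 l).
  rewrite gt_eqF// ltr_wpDl// divr_ge0//; last exact: ltW.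
  by rewrite subr_ge0 exprn_ege1// -expR0 ler_expR ltW.
have ab : a l - b l @[l --> \oo] --> (0 : R) := return_hitting_close k ks.
have Ea l : a l = (c l + 1)^-1 * (g l + (a l - b l)).
  have hl0 : h l != 0 by rewrite gt_eqF// (mu_fine_gt0 (mA l) (A0 l)).
  have E : c l * a l = g l - b l.
    rewrite /g /b !Rint_condm// -mulrBr -return_monomial_identity//.
    by rewrite /c mulrAC mulrC.
  apply: (mulfI (c1 l)); rewrite mulVKf// mulrDl E mul1r; ring.
have acvg : a l @[l --> \oo] --> (k%:R + 1)^-1 * L.
  rewrite (_ : a = fun l => (c l + 1)^-1 * (g l + (a l - b l))); last exact/funext.
  apply: cvgM; last by rewrite -[L]addr0; exact: cvgD.
  apply: cvgV => //; apply: cvgD; last exact: cvg_cst.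
  exact: expR_quotient_cvg.
split => //; rewrite -[X in _ --> X]subr0.
rewrite (_ : (fun l => _) = fun l => a l - (a l - b l)); first exact: cvgB.
by apply/funext => l; rewrite /b; ring.
Qed.

End RareEvents.

(** * Moments of exponential sequences *)

Section ExponentialMoments.
Context d (Om : measurableType d) (R : realType) (P : probability Om R)
  (E : Om -> nat -> R).
Hypothesis iidE : iid_Exp1 P E.

Let E0 w j : 0 <= E w j.
Proof. by case: iidE. Qed.

Let mE j : measurable_fun setT (fun w => E w j).
Proof. by case: iidE. Qed.

(** Truncating at [0] bounds the function on the whole line without changing it on the range of
    [E]. *)
Definition exp_pow (k : nat) (t : R) : R := expR (- Num.max t 0) ^+ k.

Lemma exp_pow_01 k t : 0 <= exp_pow k t <= 1.
Proof.
rewrite /exp_pow exprn_ge0 ?expR_ge0//= exprn_ile1 ?expR_ge0//.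
by rewrite -expR0 ler_expR oppr_le0 le_max lexx orbT.
Qed.

Lemma bm_exp_pow k : bounded_measurable (exp_pow k).
Proof.
split; last first.
  by exists 1 => t; have /andP[? ?] := exp_pow_01 k t; rewrite ger0_norm.
apply: measurable_funX; apply: (measurableT_comp (@measurable_expR R)).
apply: measurable_funN; apply: measurable_maxr; first exact: measurable_id.
exact: measurable_cst.
Qed.

Lemma exponential_moment j k : \int[P]_w exp_pow k (E w j) = (k%:R + 1)^-1.
Proof.
have k1 : 0 < k%:R + 1 :> R by rewrite ltr_wpDl.
have ipdf := @integrable_exponential_pdf R 1 ltr01.
have law (B : set R) : measurable B -> \int[P]_w (\1_B (E w j) * 1) =
    \int[lebesgue_measure]_t (\1_B t * exponential_pdf 1 t).
  move=> mB; have mEB : measurable ((fun w => E w j) @^-1` B).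
    by have := mE j measurableT mB; rewrite setTI.
  transitivity (\int[P]_w \1_((fun w => E w j) @^-1` B) w).
    by apply: eq_Rintegral => w _; rewrite mulr1.
  rewrite Rint_indic//; case: iidE => _ _ -> // _.
  rewrite /exponential_prob /Rintegral; congr fine.
  rewrite [LHS]integral_mkcond; apply: eq_integral => t _.
  by rewrite patchE indicE; case: (t \in B); rewrite ?mul1r ?mul0r.
have := @Rint_weighted_eq _ _ _ _ _ _ R P (@lebesgue_measure R) (fun w => E w j) id
  (fun=> 1) (exponential_pdf 1) (mE j) (@measurable_id _ _ setT)
  (bm_integrable_cst P 1) ipdf law (exp_pow k) (bm_exp_pow k) (exp_pow_01 k).
under eq_Rintegral => w _ do rewrite mulr1.
move=> ->.
(* [exp (- k t)] times the density of rate [1] is [1 / (k + 1)] times the density of rate [k + 1],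
   which has mass one. *)
transitivity (\int[lebesgue_measure]_t ((k%:R + 1)^-1 * exponential_pdf (k%:R + 1 : R) t)).
  apply: eq_Rintegral => t _; have [t0|t0] := leP 0 t.
    rewrite !exponential_pdfE// /exp_pow (max_idPl t0) mul1r mulrA mulVf ?mul1r ?gt_eqF//.
    by rewrite -expRM_natl -expRD; congr expR; ring.
  by rewrite !lt0_exponential_pdf// !mulr0.
rewrite RintegralZl//; last exact: integrable_exponential_pdf.
by rewrite /Rintegral integral_exponential_pdf//= mulr1.
Qed.

(** The first [m] factors are arbitrary, the others indicators. For [m = 0] this is the independence
    in [iid_Exp1]; each step frees one coordinate from indicators by [Rint_weighted_eq], with the
    other factors as weight. *)
Lemma independent_prod (n m : nat) (g : nat -> R -> R) : (m <= n)%N ->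
  (forall j, bounded_measurable (g j)) -> (forall j t, 0 <= g j t <= 1) ->
  (forall j, (m <= j < n)%N -> exists2 B, measurable B & g j = \1_B) ->
  \int[P]_w \prod_(j < n) g j (E w j) = \prod_(j < n) \int[P]_w g j (E w j).
Proof.
elim: m g => [|m ih] g mn bg g01 gind.
  have /choice[B hB] j : exists B, measurable B /\ ((j < n)%N -> g j = \1_B).
    case: (ltnP j n) => jn; last by exists setT; split.
    by have [B mB ->] := gind j jn; exists B.
  have mB j : measurable (B j) by case: (hB j).
  have gB (j : 'I_n) : g j = \1_(B j) by case: (hB j) => _; apply.
  have mEB j : measurable ((fun w => E w j) @^-1` B j).
    by have := mE j measurableT (mB j); rewrite setTI.
  transitivity (\int[P]_w \1_(\bigcap_(j in `I_n) ((fun w => E w j) @^-1` B j)) w).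
    apply: eq_Rintegral => w _; under eq_bigr => j _ do rewrite gB.
    rewrite indicE; have [h|/existsNP[j /not_implyP[jn /= h]]] :=
        pselect (forall j, `I_n j -> B j (E w j)).
      rewrite mem_set//; rewrite big1// => j _.
      by rewrite indicE mem_set//; exact: (h j (ltn_ord j)).
    rewrite memNset; last by move=> /(_ j jn).
    by rewrite (bigD1 (Ordinal jn))//= indicE memNset// mul0r.
  rewrite Rint_indic; last by apply: bigcap_measurableType => // j _; exact: mEB.
  case: iidE => _ _ _ /(_ n B mB) ->.
  transitivity (\prod_(j < n) fine (P ((fun w => E w j) @^-1` B j))).
    under eq_bigr => j _ do rewrite -(probability_fine P (mEB j)).
    by rewrite prodEFin.
  apply: eq_bigr => j _; rewrite -Rint_indic//.
  by apply: eq_Rintegral => w _; rewrite gB.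
(* Replacing [g m] by an indicator brings the family within reach of the induction hypothesis. *)
pose upd f j := if j == m then f else g j.
set i := Ordinal mn.
have rest f w : \prod_(j < n | j != i) upd f j (E w j) =
    \prod_(j < n | j != i) g j (E w j).
  by apply: eq_bigr => j ji; rewrite /upd -val_eqE in ji *; rewrite (negbTE ji).
have rest' f : \prod_(j < n | j != i) \int[P]_w upd f j (E w j) =
    \prod_(j < n | j != i) \int[P]_w g j (E w j).
  by apply: eq_bigr => j ji; rewrite /upd -val_eqE in ji *; rewrite (negbTE ji).
pose W w := \prod_(j < n | j != i) g j (E w j).
pose c := \prod_(j < n | j != i) \int[P]_w g j (E w j).
have bgE f j : bounded_measurable f -> bounded_measurable (fun w => f (E w j)).
  by move=> bf; exact: (bm_comp (mE j) bf).
have bW : bounded_measurable W by apply: bm_prod => j _; exact: bgE.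
have split1 f w : \prod_(j < n) upd f j (E w j) = f (E w m) * W w.
  by rewrite (bigD1 i)//= rest {1}/upd eqxx.
have split2 f : \prod_(j < n) \int[P]_w upd f j (E w j) =
    (\int[P]_w f (E w m)) * c.
  by rewrite (bigD1 i)//= rest' {1}/upd eqxx.
have updg : upd (g m) = g.
  by apply/funext => j; rewrite /upd; case: eqP => // ->.
have ind_eq (B : set R) : measurable B -> \int[P]_w (\1_B (E w m) * W w) =
    \int[P]_w (\1_B (E w m) * c).
  move=> mB; have bB := @bm_indic _ _ R _ mB.
  under eq_Rintegral => w _ do rewrite -split1.
  rewrite ih; [|exact: ltnW| | |].
  - rewrite split2; under [RHS]eq_Rintegral => w _ do rewrite mulrC.
    by rewrite RintZ; [rewrite mulrC|exact: bgE].
  - by move=> j; rewrite /upd; case: ifP.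
  - by move=> j t; rewrite /upd; case: ifP => // _; rewrite indicE; case: (_ \in _); rewrite ?lexx ?ler01.
  - move=> j /andP[mj jn]; rewrite /upd; case: eqP => [_|/eqP jm]; first by exists B.
    by apply: gind; rewrite jn andbT ltn_neqAle eq_sym jm.
have := @Rint_weighted_eq _ _ _ _ _ _ R P P (fun w => E w m) (fun w => E w m)
  W (fun=> c) (mE m) (mE m) (bm_integrable P bW) (bm_integrable_cst P c) ind_eq
  (g m) (bg m) (g01 m).
under eq_Rintegral => w _ do rewrite -split1.
rewrite updg => ->.
under eq_Rintegral => w _ do rewrite mulrC.
by rewrite RintZ; [rewrite mulrC -split2 updg|exact: bgE].
Qed.

Lemma exponential_moments (n : nat) (k : nat -> nat) :
  \int[P]_w \prod_(j < n) expN (E w j)%:E ^+ k j =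
  \prod_(j < n) ((k j)%:R + 1)^-1.
Proof.
transitivity (\int[P]_w \prod_(j < n) exp_pow (k j) (E w j)).
  apply: eq_Rintegral => w _; apply: eq_bigr => j _.
  by rewrite /exp_pow (max_idPl (E0 w j)).
rewrite (@independent_prod n n (fun j => exp_pow (k j)))//.
- by apply: eq_bigr => j _; rewrite exponential_moment.
- by move=> j; exact: bm_exp_pow.
- by move=> j t; exact: exp_pow_01.
- by move=> j /andP[/leq_ltn_trans h /h]; rewrite ltnn.
Qed.

End ExponentialMoments.

(** * Bernstein polynomials in several variables *)

Section Bernstein.
Context {R : realType}.
Implicit Types u a : R.

(* The weight of [i] under the binomial distribution with parameters [m] and
   [u], by Pascal's recursion. *)
Fixpoint bernstein (m i : nat) u : R :=
  if m is m'.+1 then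
    u * (if i is i'.+1 then bernstein m' i' u else 0) + (1 - u) * bernstein m' i u
  else (i == 0)%:R.

Lemma bernstein_ge0 m i u : 0 <= u <= 1 -> 0 <= bernstein m i u.
Proof.
move=> /andP[u0 u1]; elim: m i => [|m ih] i /=; first exact: ler0n.
rewrite addr_ge0// mulr_ge0 ?subr_ge0//; by case: i.
Qed.

Lemma bernstein_out m i u : (m < i)%N -> bernstein m i u = 0.
Proof.
elim: m i => [|m ih] [|i] //= mi; rewrite !ih ?mulr0 ?addr0//.
exact: leqW.
Qed.

(** Conditioning on one Bernoulli trial: it succeeds with probability [u] and then shifts the
    argument of [g] by one. *)
Lemma bernstein_sumS m (g : nat -> R) u :
  \sum_(i < m.+2) g i * bernstein m.+1 i u =
  u * (\sum_(i < m.+1) g i.+1 * bernstein m i u) +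
  (1 - u) * \sum_(i < m.+1) g i * bernstein m i u.
Proof.
under eq_bigr => i _ do rewrite /= mulrDr mulrCA [g i * ((1 - u) * _)]mulrCA.
rewrite big_split/= -!mulr_sumr; congr (_ * _ + _ * _).
  by rewrite big_ord_recl/= mulr0 add0r; apply: eq_bigr.
by rewrite big_ord_recr/= bernstein_out// mulr0 addr0.
Qed.

Lemma bernstein_sum1 m u : \sum_(i < m.+1) bernstein m i u = 1.
Proof.
under eq_bigr => i _ do rewrite -[bernstein _ _ _]mul1r.
elim: m => [|m ih]; first by rewrite big_ord_recl big_ord0 /= mul1r addr0.
by rewrite (bernstein_sumS m (fun=> 1)) ih; ring.
Qed.

(** The second moment about an arbitrary [a]: a successful trial moves the centre to [a - 1], so [a]
    must vary in the induction. *)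
Lemma bernstein_variance m u a :
  \sum_(i < m.+1) (i%:R - a) ^+ 2 * bernstein m i u =
  (m%:R * u - a) ^+ 2 + m%:R * (u * (1 - u)).
Proof.
elim: m a => [|m ih] a.
  by rewrite big_ord_recl big_ord0 /= mulr1 addr0 !mul0r addr0.
rewrite (bernstein_sumS m (fun i => (i%:R - a) ^+ 2)) ih.
have -> : \sum_(i < m.+1) (i.+1%:R - a) ^+ 2 * bernstein m i u =
    \sum_(i < m.+1) (i%:R - (a - 1)) ^+ 2 * bernstein m i u.
  by apply: eq_bigr => i _; rewrite -natr1; congr (_ ^+ 2 * _); ring.
by rewrite ih -natr1; ring.
Qed.

Lemma bernstein_dispersion m u : (0 < m)%N -> 0 <= u <= 1 ->
  \sum_(i < m.+1) (u - i%:R / m%:R) ^+ 2 * bernstein m i u <= m%:R^-1.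
Proof.
move=> m0 /andP[u0 u1]; have m0R : m%:R != 0 :> R by rewrite pnatr_eq0 -lt0n.
have -> : \sum_(i < m.+1) (u - i%:R / m%:R) ^+ 2 * bernstein m i u =
    m%:R^-1 ^+ 2 * \sum_(i < m.+1) (i%:R - m%:R * u) ^+ 2 * bernstein m i u.
  rewrite mulr_sumr; apply: eq_bigr => i _; rewrite mulrA -exprMn.
  by congr (_ * _); rewrite mulrBr mulKf// -sqrrN opprB mulrC.
rewrite bernstein_variance subrr expr0n/= add0r expr2 -mulrA (mulKf m0R).
by rewrite -[leRHS]mulr1 ler_wpM2l ?invr_ge0// mulr_ile1// ?subr_ge0// lerBlDr lerDl.
Qed.

Section Multivariate.
Variables (n m : nat).
Hypothesis m0 : (0 < m)%N.

Definition bernstein_weight (phi : {ffun 'I_n -> 'I_m.+1}) (u : nat -> R) : R :=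
  \prod_(j < n) bernstein m (phi j) (u j).

Lemma bernstein_weight_ge0 phi (u : nat -> R) : (forall j, 0 <= u j <= 1) ->
  0 <= bernstein_weight phi u.
Proof. by move=> u01; apply: prodr_ge0 => j _; exact: bernstein_ge0. Qed.

Lemma bernstein_weight_sum1 (u : nat -> R) :
  \sum_(phi : {ffun 'I_n -> 'I_m.+1}) bernstein_weight phi u = 1.
Proof.
rewrite /bernstein_weight
  -(bigA_distr_bigA (fun (j : 'I_n) (i : 'I_m.+1) => bernstein m i (u j))).
by rewrite big1// => j _; exact: bernstein_sum1.
Qed.

(** The sum of products factors over coordinates; all but the [j]-th factor are total masses equal
    to one. *)
Lemma bernstein_weight_dispersion (u : nat -> R) (j : 'I_n) : (forall j, 0 <= u j <= 1) ->
  \sum_(phi : {ffun 'I_n -> 'I_m.+1})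
    (u j - (phi j)%:R / m%:R) ^+ 2 * bernstein_weight phi u <= m%:R^-1.
Proof.
move=> u01; pose G (j' : 'I_n) (i : 'I_m.+1) :=
  (if j' == j then (u j - i%:R / m%:R) ^+ 2 else 1) * bernstein m i (u j').
have -> : \sum_(phi : {ffun 'I_n -> 'I_m.+1})
    (u j - (phi j)%:R / m%:R) ^+ 2 * bernstein_weight phi u =
    \sum_(phi : {ffun 'I_n -> 'I_m.+1}) \prod_(j' < n) G j' (phi j').
  apply: eq_bigr => phi _; rewrite /bernstein_weight /G big_split/=; congr (_ * _).
  by rewrite (bigD1 j)//= eqxx big1 ?mulr1// => j' /negbTE ->.
rewrite -(bigA_distr_bigA G) (bigD1 j)//= [X in _ * X]big1 ?mulr1.
  by rewrite /G eqxx; exact: bernstein_dispersion.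
move=> j' /negbTE j'j; rewrite /G j'j.
by under eq_bigr => i _ do rewrite mul1r; exact: bernstein_sum1.
Qed.

(** With a modulus of the form [e] plus a multiple of squared distances, averaging turns the squares
    directly into variances, each at most [1 / m], and no splitting into near and far lattice points
    occurs. *)
Lemma bernstein_approx (F : (nat -> R) -> R) (e C : R) (u : nat -> R)
    (pt : {ffun 'I_n -> 'I_m.+1} -> nat -> R) :
  0 <= C -> (forall j, 0 <= u j <= 1) ->
  (forall phi (j : 'I_n), pt phi j = (phi j)%:R / m%:R) ->
  (forall phi, `|F u - F (pt phi)| <= e + C * \sum_(j < n) (u j - pt phi j) ^+ 2) ->
  `|F u - \sum_(phi : {ffun 'I_n -> 'I_m.+1}) F (pt phi) * bernstein_weight phi u| <=
  e + C * (n%:R / m%:R).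
Proof.
move=> C0 u01 ptE modulus.
have w0 phi := bernstein_weight_ge0 phi u01.
rewrite -[X in `|X - _|]mulr1 -(bernstein_weight_sum1 u) mulr_sumr -sumrB.
apply: (le_trans (ler_norm_sum _ _ _)).
apply: (@le_trans _ _ (\sum_(phi : {ffun 'I_n -> 'I_m.+1})
   (e + C * \sum_(j < n) (u j - pt phi j) ^+ 2) * bernstein_weight phi u)).
  by apply: ler_sum => phi _; rewrite -mulrBl normrM (ger0_norm (w0 phi)) ler_wpM2r.
under eq_bigr => phi _ do rewrite mulrDl -mulrA mulr_suml.
rewrite big_split/= -!mulr_sumr bernstein_weight_sum1 mulr1 lerD2l ler_wpM2l//.
rewrite exchange_big/=.
apply: (@le_trans _ _ (\sum_(j < n) m%:R^-1)); last first.
  by rewrite sumr_const card_ord -[X in X <= _]mulr_natl.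
apply: ler_sum => j _; under eq_bigr => phi _ do rewrite ptE.
exact: bernstein_weight_dispersion.
Qed.

End Multivariate.
End Bernstein.

(** * Polynomial functions of finitely many coordinates *)

Section PolynomialFunctions.
Context {R : realType}.
Variable n : nat.

Definition eval_monomials (ts : seq (R * (nat -> nat))) (u : nat -> R) : R :=
  \sum_(t <- ts) t.1 * \prod_(j < n) u j ^+ t.2 j.

Definition polyfun (Q : (nat -> R) -> R) :=
  exists ts, forall u, Q u = eval_monomials ts u.

Lemma polyfun_cst c : polyfun (fun=> c).
Proof.
exists [:: (c, fun=> 0%N)] => u; rewrite /eval_monomials big_seq1 big1 ?mulr1//.
Qed.

Lemma polyfun_coord (j : 'I_n) : polyfun (fun u => u j).
Proof.
exists [:: (1, fun i => nat_of_bool (i == j :> nat))] => u.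
rewrite /eval_monomials big_seq1 mul1r (bigD1 j)//= eqxx expr1 big1 ?mulr1//.
by move=> i; rewrite -val_eqE => /negbTE /= ->.
Qed.

Lemma polyfunD Q1 Q2 : polyfun Q1 -> polyfun Q2 -> polyfun (fun u => Q1 u + Q2 u).
Proof.
move=> [t1 h1] [t2 h2]; exists (t1 ++ t2) => u.
by rewrite h1 h2 /eval_monomials big_cat.
Qed.

Lemma polyfunM Q1 Q2 : polyfun Q1 -> polyfun Q2 -> polyfun (fun u => Q1 u * Q2 u).
Proof.
move=> [t1 h1] [t2 h2].
exists [seq (s.1 * t.1, fun j => (s.2 j + t.2 j)%N) | s <- t1, t <- t2] => u.
rewrite h1 h2 /eval_monomials big_allpairs_dep mulr_suml; apply: eq_bigr => s _.
rewrite mulr_sumr; apply: eq_bigr => t _ /=.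
rewrite mulrACA -big_split/=; congr (_ * _); apply: eq_bigr => j _.
by rewrite exprD.
Qed.

Lemma polyfun_sum (I : Type) (s : seq I) (Q : I -> (nat -> R) -> R) :
  (forall i, polyfun (Q i)) -> polyfun (fun u => \sum_(i <- s) Q i u).
Proof.
move=> pQ; elim: s => [|i s ih].
  by have [ts h] := polyfun_cst 0; exists ts => u; rewrite big_nil -(h u).
by have [ts h] := polyfunD (pQ i) ih; exists ts => u; rewrite big_cons h.
Qed.

Lemma polyfun_prod (I : Type) (s : seq I) (Q : I -> (nat -> R) -> R) :
  (forall i, polyfun (Q i)) -> polyfun (fun u => \prod_(i <- s) Q i u).
Proof.
move=> pQ; elim: s => [|i s ih].
  by have [ts h] := polyfun_cst 1; exists ts => u; rewrite big_nil -(h u).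
by have [ts h] := polyfunM (pQ i) ih; exists ts => u; rewrite big_cons h.
Qed.

Lemma polyfun_bernstein m i (j : 'I_n) : polyfun (fun u => bernstein m i (u j)).
Proof.
elim: m i => [|m ih] i /=; first exact: polyfun_cst.
apply: polyfunD; apply: polyfunM => //; first exact: polyfun_coord.
- by case: i => [|i]; [exact: polyfun_cst|exact: ih].
- apply: polyfunD; first exact: polyfun_cst.
  have [ts h] := polyfunM (polyfun_cst (-1)) (polyfun_coord j).
  by exists ts => u; rewrite -h mulN1r.
Qed.

End PolynomialFunctions.

(** * Weak convergence on the sequence space *)

Section SequenceSpace.
Context {R : realType}.
Implicit Types (s t : nat -> \bar R) (f : (nat -> \bar R) -> R).

(** The inverse of [expN] on [[0, 1]], sending [0] to [+oo]; coordinatewise it identifies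
    [[0, oo]^N] with the cube. *)
Definition invN (v : R) : \bar R := if v <= 0 then +oo%E else (- ln v)%:E.

Lemma invNK v : 0 <= v -> expN (invN v) = v.
Proof.
rewrite /invN => v0; case: leP => [v0'|v0'] /=.
  by apply/eqP; rewrite eq_le v0 v0'.
by rewrite opprK lnK.
Qed.

Lemma expNK (x : \bar R) : (0 <= x)%E -> invN (expN x) = x.
Proof.
rewrite /invN; case: x => [r| |] //=; last by rewrite lexx.
by move=> _; rewrite leNgt expR_gt0/= expRK opprK.
Qed.

Lemma invN_ge0 v : v <= 1 -> (0 <= invN v)%E.
Proof.
by rewrite /invN => v1; case: ifP => // _; rewrite lee_fin oppr_ge0 ln_le0.
Qed.

Lemma expN_01 (x : \bar R) : (0 <= x)%E -> 0 <= expN x <= 1.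
Proof.
case: x => [r| |] //=; last by rewrite lexx ler01.
by rewrite lee_fin expR_ge0 => r0; rewrite -expR0 ler_expR oppr_le0.
Qed.

Lemma dist_01 (a b : R) : 0 <= a <= 1 -> 0 <= b <= 1 -> `|a - b| <= 1.
Proof. by move=> /andP[? ?] /andP[? ?]; rewrite ler_norml; apply/andP; split; lra. Qed.

Lemma half_pow_sum N : \sum_(j < N) (2%:R ^- j.+1 : R) = 1 - 2%:R ^- N.
Proof.
elim: N => [|N ih]; first by rewrite big_ord0 expr0 invr1 subrr.
rewrite big_ord_recr/= ih exprS invfM.
set x := (2 ^+ N)^-1; lra.
Qed.

Lemma half_pow_tail n N :
  \sum_(j < N) (2%:R ^- j.+1 : R) * (n <= j)%N%:R <= 2%:R ^- n - 2%:R ^- maxn N n.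
Proof.
elim: N => [|N ih]; first by rewrite big_ord0 max0n subrr.
rewrite big_ord_recr/=; case: (leqP n N) => nN.
  rewrite (maxn_idPl nN) in ih; rewrite (maxn_idPl (leqW nN)) mulr1.
  rewrite exprS invfM; move: ih; set S := \sum_(i < N) _.
  set x := (2 ^+ N)^-1; set y := (2 ^+ n)^-1; lra.
rewrite (maxn_idPr (ltnW nN)) in ih.
by rewrite (maxn_idPr nN) mulr0 addr0.
Qed.

(** The first [n] weights add up to less than one, and the remaining ones to [2^-n] with each
    distance at most one. *)
Lemma dseq_le s t n (c : R) : nonneg_seq s -> nonneg_seq t -> 0 <= c ->
  (forall j, (j < n)%N -> `|expN (s j) - expN (t j)| <= c) ->
  (dseq s t <= (c + 2%:R ^- n)%:E)%E.
Proof.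
move=> s0 t0 c0 h; rewrite /dseq; apply: lime_le.
  by apply: is_cvg_nneseries => j _ _; rewrite lee_fin mulr_ge0.
apply: nearW => N; rewrite sumEFin lee_fin big_mkord.
apply: (@le_trans _ _ (\sum_(j < N) (2%:R ^- j.+1 * c + 2%:R ^- j.+1 * (n <= j)%N%:R))).
  apply: ler_sum => j _; rewrite -mulrDr ler_wpM2l ?invr_ge0 ?exprn_ge0//.
  case: (leqP n j) => jn; last by rewrite addr0 h.
  by rewrite (le_trans (dist_01 (expN_01 (s0 j)) (expN_01 (t0 j))))// lerDr.
rewrite big_split/= -mulr_suml half_pow_sum; apply: lerD.
  by rewrite ler_piMl// lerBlDr lerDl invr_ge0 exprn_ge0.
by rewrite (le_trans (half_pow_tail n N))// lerBlDr lerDl invr_ge0 exprn_ge0.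
Qed.

Lemma half_pow_small (c : R) : 0 < c -> exists n, 2%:R ^- n < c.
Proof.
move=> c0; have ci : 0 <= c^-1 by rewrite invr_ge0 ltW.
exists (Num.bound c^-1); rewrite -[ltRHS]invrK ltf_pV2 ?posrE ?exprn_gt0 ?invr_gt0//.
apply: (lt_le_trans (archi_boundP ci)).
by rewrite -natrX ler_nat ltnW// ltn_expl.
Qed.

Lemma nbhs_coords (p : prod_topology (fun _ : nat => R)) n (c : R) : 0 < c ->
  nbhs p [set v : prod_topology (fun _ : nat => R) |
    forall j, (j < n)%N -> `|p j - v j| < c].
Proof.
move=> c0; have FF : Filter (nbhs p) by exact: nbhs_filter.
elim: n => [|n ih]; first by apply: filterS filterT => v _ j.
have hn : nbhs p [set v : prod_topology (fun _ : nat => R) | `|p n - v n| < c].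
  have := @proj_continuous nat (fun=> R) n p [set y | `|p n - y| < c].
  by apply; exact: (nbhsx_ballx (p n) _ c0).
apply: filterS (filterI ih hn) => v [h1 h2] j.
by rewrite ltnS leq_eqVlt => /orP[/eqP -> //|]; exact: h1.
Qed.

(** If it failed for every [n = C = i], there would be pairs [s], [t] with [f]-gap above [e + i]
    times their squared distance. As [f] is bounded, [s] and [t] merge in each coordinate, and
    continuity at a cluster point of the [s] contradicts the gap. *)
Lemma bcont_modulus f (e : R) : bcont f -> 0 < e -> exists n (C : R), 0 <= C /\
  forall s t, nonneg_seq s -> nonneg_seq t ->
    `|f s - f t| <= e + C * \sum_(j < n) (expN (s j) - expN (t j)) ^+ 2.
Proof.
move=> [[M fM] fc] e0; apply: contrapT => H.
have /choice[st hst] i : exists st : (nat -> \bar R) * (nat -> \bar R),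
    [/\ nonneg_seq st.1, nonneg_seq st.2 &
     e + i%:R * \sum_(j < i) (expN (st.1 j) - expN (st.2 j)) ^+ 2 <
     `|f st.1 - f st.2|].
  apply: contrapT => h; apply: H; exists i, i%:R; split=> // s t s0 t0.
  by rewrite leNgt; apply/negP => lt; apply: h; exists (s, t).
pose u i : nat -> R := fun j => expN ((st i).1 j).
have uK i : [set v : nat -> R | forall j, `[0, 1]%classic (v j)] (u i).
  by move=> j /=; rewrite in_itv/=; apply: expN_01; case: (hst i).
(* The cube is compact in the product topology; a cluster point replaces a convergent
   subsequence. *)
have K := @tychonoff nat (fun=> R) _ (fun=> @segment_compact R 0 1).
have [|p [p01 pcl]] := K (u i @[i --> \oo]) _.
  by exists 0%N => // i _; exact: uK.
have {}p01 j : 0 <= p j <= 1 by have := p01 j; rewrite /= in_itv.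
pose sp j := invN (p j).
have sp0 : nonneg_seq sp by move=> j; apply: invN_ge0; case/andP: (p01 j).
have spE j : expN (sp j) = p j by rewrite invNK//; case/andP: (p01 j).
have e2 : 0 < e / 2 by lra.
have [c [c0 hc]] := fc _ sp0 _ e2.
have c4 : 0 < c / 4 by lra.
have [n hn] := half_pow_small c4.
have M0 : 0 <= M by rewrite (le_trans _ (fM _ sp0)).
have B0 : 0 <= 2 * M / (c / 4) ^+ 2 by rewrite divr_ge0 ?sqr_ge0// mulr_ge0.
(* For [i >= N] the sum over [j < i] contains the first [n] coordinates, and a gap above [c / 4] in
   one of them would push [i] times the sum past [2 M], the largest possible gap of [f]. *)
set N := maxn n (Num.bound (2 * M / (c / 4) ^+ 2)).
have [_ [[i Ni <-] hi]] :
    [set v | exists2 i, (N <= i)%N & u i = v] `&`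
    [set v : nat -> R | forall j, (j < n)%N -> `|p j - v j| < c / 4] !=set0.
  apply: pcl; last exact: nbhs_coords.
  by exists N => // i Ni; exists i.
have [s0 t0 lt] := hst i; set s := (st i).1 in s0 lt *; set t := (st i).2 in t0 lt *.
have near_t j : (j < n)%N -> `|expN (s j) - expN (t j)| <= c / 4.
  move=> jn; have ji : (j < i)%N.
    by rewrite (leq_trans jn)// (leq_trans (leq_maxl _ _) Ni).
  rewrite -(@ler_pXn2r _ 2) ?nnegrE//; last exact: ltW.
  rewrite real_normK ?num_real//.
  have fst : `|f s - f t| <= 2 * M.
    rewrite (le_trans (ler_normB _ _))//.
    by have := fM _ s0; have := fM _ t0; lra.
  have iB : 2 * M / (c / 4) ^+ 2 < i%:R.
    by rewrite (lt_le_trans (archi_boundP B0))// ler_nat (leq_trans (leq_maxr _ _) Ni).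
  have i0 : 0 < i%:R :> R by exact: le_lt_trans iB.
  have term : (expN (s j) - expN (t j)) ^+ 2 <=
      \sum_(j < i) (expN (s j) - expN (t j)) ^+ 2.
    rewrite (bigD1 (Ordinal ji))//= lerDl; apply: sumr_ge0 => k _; exact: sqr_ge0.
  rewrite leNgt; apply/negP => big.
  move: iB; rewrite ltr_pdivrMr; last by rewrite exprn_gt0.
  move=> iB; have : i%:R * (c / 4) ^+ 2 <= i%:R * \sum_(j < i) (expN (s j) - expN (t j)) ^+ 2.
    by rewrite ler_wpM2l// (le_trans (ltW big)).
  move: lt fst e0 iB; lra.
have cs : (dseq sp s < c%:E)%E.
  apply: (@le_lt_trans _ _ (c / 4 + 2%:R ^- n)%:E); last by rewrite lte_fin; lra.
  apply: dseq_le => //; first exact: ltW.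
  by move=> j jn; rewrite spE ltW//; exact: hi.
have ct : (dseq sp t < c%:E)%E.
  (* [t] is within [c / 4] of [s], which is within [c / 4] of the cluster point; the tail adds less
     than [c / 4]. *)
  apply: (@le_lt_trans _ _ (c / 2 + 2%:R ^- n)%:E); last by rewrite lte_fin; lra.
  apply: dseq_le => //; first by lra.
  move=> j jn; rewrite spE (_ : c / 2 = c / 4 + c / 4); last by lra.
  apply: le_trans (ler_distD (expN (s j)) _ _) _.
  by apply: lerD; [rewrite ltW//; exact: hi|exact: near_t].
have h1 := hc _ s0 cs; have h2 := hc _ t0 ct.
have : `|f s - f t| < e.
  rewrite (_ : e = e / 2 + e / 2); last by lra.
  apply: le_lt_trans (ler_distD (f sp) _ _) _; apply: ltrD => //.
  by rewrite distrC.
have : 0 <= i%:R * \sum_(j < i) (expN (s j) - expN (t j)) ^+ 2.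
  by rewrite mulr_ge0// sumr_ge0// => j _; exact: sqr_ge0.
lra.
Qed.

Lemma bcont_poly_approx f (e : R) : bcont f -> 0 < e ->
  exists n ts, forall s, nonneg_seq s ->
    `|f s - eval_monomials n ts (fun j => expN (s j))| <= e.
Proof.
move=> cf e0; have e2 : 0 < e / 2 by lra.
have [n [C [C0 mod_f]]] := bcont_modulus cf e2.
have B0 : 0 <= C * n%:R / (e / 2) by rewrite divr_ge0 ?mulr_ge0// ltW.
set m := (Num.bound (C * n%:R / (e / 2))).+1.
have m0 : (0 < m)%N by [].
have m0R : 0 < m%:R :> R by rewrite ltr0n.
have hm : C * (n%:R / m%:R) <= e / 2.
  rewrite mulrA ler_pdivrMr// [leRHS]mulrC -ler_pdivrMr//.
  by rewrite (le_trans (ltW (archi_boundP B0)))// ler_nat.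
(* Coordinates from [n] on are set to [0], that is to [+oo] under [invN]; the modulus sees only the
   first [n]. *)
pose pt (phi : {ffun 'I_n -> 'I_m.+1}) (j : nat) : R :=
  if insub j is Some j' then (phi j')%:R / m%:R else 0.
have ptE phi (j : 'I_n) : pt phi j = (phi j)%:R / m%:R by rewrite /pt valK.
have pt01 phi j : 0 <= pt phi j <= 1.
  rewrite /pt; case: insub => [j'|]; last by rewrite lexx ler01.
  by rewrite divr_ge0//= ler_pdivrMr// mul1r ler_nat -ltnS.
pose F (u : nat -> R) := f (fun j => invN (u j)).
have inv0 (u : nat -> R) : (forall j, 0 <= u j <= 1) -> nonneg_seq (fun j => invN (u j)).
  by move=> u01 j; apply: invN_ge0; case/andP: (u01 j).
have [ts hts] : polyfun n (fun u =>
    \sum_(phi : {ffun 'I_n -> 'I_m.+1}) F (pt phi) * bernstein_weight phi u).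
  apply: polyfun_sum => phi; apply: polyfunM; first exact: polyfun_cst.
  by apply: polyfun_prod => j; exact: polyfun_bernstein.
exists n, ts => s s0; rewrite -hts.
have u01 j : 0 <= expN (s j) <= 1 by exact: expN_01.
have -> : f s = F (fun j => expN (s j)).
  by congr f; apply/funext => j; rewrite expNK.
rewrite (_ : e = e / 2 + e / 2); last by lra.
apply: le_trans (bernstein_approx m0 (e := e / 2) C0 u01 ptE _) _; last by rewrite lerD2l.
move=> phi; apply: le_trans (mod_f _ _ (inv0 _ u01) (inv0 _ (pt01 phi))) _.
rewrite lerD2l ler_wpM2l//; apply: ler_sum => j _.
rewrite !invNK ?lexx//; first by case/andP: (pt01 phi j).
by case/andP: (u01 j).
Qed.

End SequenceSpace.

(** * From convergence of moments to weak convergence *)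

Section WeakConvergence.
Context {R : realType}.

Lemma bm_eval_monomials d (X : measurableType d) (u : X -> nat -> R) n ts :
  (forall j, bounded_measurable (fun x => u x j)) ->
  bounded_measurable (fun x => eval_monomials n ts (u x)).
Proof.
move=> bu; apply: bm_sum => t _; apply: bmZ; apply: bm_prod => j _.
exact: bmX (bu j).
Qed.

Lemma bm_expN_seq d (X : measurableType d) (S : X -> nat -> \bar R) j :
  (forall x, nonneg_seq (S x)) -> measurable_fun setT (fun x => expN (S x j)) ->
  bounded_measurable (fun x => expN (S x j)).
Proof.
move=> S0 mS; split => //; exists 1 => x.
by have /andP[? ?] := expN_01 (S0 x j); rewrite ger0_norm.
Qed.

(** [bcont] is a metric condition only; measurability comes from writing [f] as a limit of
    polynomials in the measurable coordinates. *)
Lemma bm_bcont d (X : measurableType d) (S : X -> nat -> \bar R) f :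
  (forall x, nonneg_seq (S x)) ->
  (forall j, measurable_fun setT (fun x => expN (S x j))) -> bcont f ->
  bounded_measurable (fun x => f (S x)).
Proof.
move=> S0 mS cf; split; last by have [[M fM] _] := cf; exists M => x; exact: fM.
have /choice[nt hnt] i : exists nt : nat * seq (R * (nat -> nat)),
    forall s, nonneg_seq s ->
    `|f s - eval_monomials nt.1 nt.2 (fun j => expN (s j))| <= i.+1%:R^-1.
  have i0 : 0 < i.+1%:R^-1 :> R by rewrite invr_gt0.
  have [n [ts h]] := bcont_poly_approx cf i0.
  by exists (n, ts).
apply: (measurable_fun_cvg
    (h := fun i x => eval_monomials (nt i).1 (nt i).2 (fun j => expN (S x j)))).
  move=> i; apply: (bm_eval_monomials _ _ _).1 => j.
  exact: bm_expN_seq.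
move=> x _; apply/cvgrPdist_le => e e0.
have e1 : 0 <= e^-1 by rewrite invr_ge0 ltW.
exists (Num.bound e^-1) => // i /= hi; apply: (le_trans (hnt i _ (S0 x))).
rewrite -[leRHS]invrK lef_pV2 ?posrE ?invr_gt0//.
by rewrite (le_trans (ltW (archi_boundP e1)))// ler_nat leqW.
Qed.

(** Polynomials in the [expN] coordinates converge by linearity, the assumed limits being the
    moments of [E]; uniform approximation of [f] costs [e / 3] on either side. *)
Lemma weak_cvg_of_moments d (X : measurableType d) (P : nat -> probability X R)
    (S : nat -> X -> nat -> \bar R) :
  (forall l x, nonneg_seq (S l x)) ->
  (forall l j, measurable_fun setT (fun x => expN (S l x j))) ->
  (forall n (k : nat -> nat),
    \int[P l]_x \prod_(j < n) expN (S l x j) ^+ k j @[l --> \oo] -->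
    \prod_(j < n) ((k j)%:R + 1 : R)^-1) ->
  weak_cvg_Exp (fun l => P l : {measure set X -> \bar R}) S.
Proof.
move=> S0 mS moments d' Om Q E iidE f cf.
have bS l j := bm_expN_seq (S0 l) (mS l j).
pose S' w j := (E w j)%:E.
have S'0 w : nonneg_seq (S' w) by move=> j; rewrite lee_fin; case: iidE.
have mS' j : measurable_fun setT (fun w => expN (S' w j)).
  rewrite /S' /=; apply: (measurableT_comp (@measurable_expR R)).
  by apply: measurable_funN; case: iidE.
have bS' j := bm_expN_seq S'0 (mS' j).
have bf l := bm_bcont (S0 l) (mS l) cf; have bf' := bm_bcont S'0 mS' cf.
have polys n ts : \int[P l]_x eval_monomials n ts (fun j => expN (S l x j))
    @[l --> \oo] --> \int[Q]_w eval_monomials n ts (fun j => expN (S' w j)).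
  elim: ts => [|t ts ih].
    under eq_fun => l.
      under eq_Rintegral => x _ do rewrite /eval_monomials big_nil.
      rewrite Rint_cst; over.
    under eq_Rintegral => x _ do rewrite /eval_monomials big_nil.
    by rewrite Rint_cst; exact: cvg_cst.
  have split d1 (Y : measurableType d1) (P' : probability Y R) (v : Y -> nat -> R) :
      (forall j, bounded_measurable (fun y => v y j)) ->
      \int[P']_y eval_monomials n (t :: ts) (v y) =
      t.1 * \int[P']_y (\prod_(j < n) v y j ^+ t.2 j) +
      \int[P']_y eval_monomials n ts (v y).
    move=> bv; under eq_Rintegral => y _ do rewrite /eval_monomials big_cons.
    have bp : bounded_measurable (fun y => \prod_(j < n) v y j ^+ t.2 j).
      by apply: bm_prod => j _; exact: bmX (bv j).
    rewrite RintD; [|exact: bmZ|exact: bm_eval_monomials].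
    by rewrite RintZ.
  rewrite split//; under eq_fun => l do rewrite split//.
  apply: cvgD => //; apply: cvgMr.
  by rewrite (exponential_moments iidE); exact: moments.
rewrite -EFin_Rint//; under eq_fun => l do rewrite -EFin_Rint//.
apply/fine_cvgP; split; first exact: nearW.
apply/cvgrPdist_le => e e0; have e3 : 0 < e / 3 by lra.
have [n [ts h]] := bcont_poly_approx cf e3.
have /cvgrPdist_le/(_ _ e3) := polys n ts; apply: filterS => l hl /=.
have h1 : `|\int[Q]_w f (S' w) -
    \int[Q]_w eval_monomials n ts (fun j => expN (S' w j))| <= e / 3.
  by apply: Rint_dist_cst => // [|w]; [exact: bm_eval_monomials|exact: h].
have h2 : `|\int[P l]_x eval_monomials n ts (fun j => expN (S l x j)) -
    \int[P l]_x f (S l x)| <= e / 3.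
  rewrite distrC.
  by apply: Rint_dist_cst => // [|x]; [exact: bm_eval_monomials|exact: h].
rewrite (_ : e = e / 3 + (e / 3 + e / 3)); last by lra.
apply: le_trans (ler_distD _ _ _) (lerD h1 _).
exact: le_trans (ler_distD _ _ _) (lerD hl h2).
Qed.

End WeakConvergence.

(** * Poisson asymptotics *)

Section PoissonAsymptotics.
Context d (X : measurableType d) (R : realType) (mu : probability X R)
  (T : X -> X) (A : nat -> set X) (mA : forall l, measurable (A l)).
Hypothesis mp : measure_preserving mu T.
Hypothesis erg : ergodic mu T.
Hypothesis A0 : forall l, (0 < mu (A l))%E.
Hypothesis Acvg : (mu (A l) @[l --> \oo] --> 0)%E.

(** The offset [m] lets the induction pass to the induced map, which shifts the sequence by one. *)
Lemma return_monomial_prod (B : set X) (k : nat -> nat) n m x :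
  return_monomial mu T B [seq k j | j <- iota m n] x =
  \prod_(j < n) expN (scaled_Phi mu T B x j) ^+ k (m + j)%N.
Proof.
elim: n m x => [|n ih] m x /=; first by rewrite big_ord0.
rewrite ih big_ord_recl/= addn0; congr (_ * _); apply: eq_bigr => j _.
by rewrite addSnnS /scaled_Phi -iterSr.
Qed.

Lemma scaled_Phi_ge0 l x : nonneg_seq (scaled_Phi mu T (A l) x).
Proof. by move=> j; rewrite mule_ge0//; exact: hit_time_ge0. Qed.

Lemma measurable_expN_scaled_Phi l j :
  measurable_fun setT (fun x => expN (scaled_Phi mu T (A l) x j)).
Proof.
have mi : measurable_fun setT (iter j (@induced_map d X R T (A l))).
  elim: j => [|j ih]; first exact: measurable_id.
  exact: (measurableT_comp (measurable_induced_map R mp.1 (mA l)) ih).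
exact: (measurableT_comp (bm_expN_hit mp (mA l) (A0 l)).1 mi).
Qed.

Lemma poisson_of_moments (P : nat -> probability X R) :
  (forall ks, \int[P l]_x return_monomial mu T (A l) ks x @[l --> \oo] -->
    \prod_(k <- ks) (k%:R + 1 : R)^-1) ->
  weak_cvg_Exp (fun l => P l : {measure set X -> \bar R})
    (fun l => scaled_Phi mu T (A l)).
Proof.
move=> moments; apply: weak_cvg_of_moments.
- exact: scaled_Phi_ge0.
- exact: measurable_expN_scaled_Phi.
move=> n k; have := moments [seq k j | j <- iota 0 n].
rewrite big_map -(big_mkord xpredT (fun j => ((k j)%:R + 1 : R)^-1)).
rewrite /index_iota subn0.
under eq_fun => l.
  under eq_Rintegral => x _ do rewrite return_monomial_prod.
  over.
exact.
Qed.

Lemma poisson_of_close :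
  (forall eps : R, 0 < eps ->
    exists (nu : nat -> set X -> \bar R) (tau : nat -> X -> nat),
      (forall l, inP mu (nu l)) /\
      (forall l, dP (nu l) (condm mu (mA l)) < eps%:E)%E /\
      conditions123 mu T A nu tau) ->
  weak_cvg_Exp (fun l => condm mu (mA l)) (fun l => scaled_Phi mu T (A l)) /\
  weak_cvg_Exp (fun l => mu : {measure set X -> \bar R})
    (fun l => scaled_Phi mu T (A l)).
Proof.
move=> close; have moments ks := return_monomial_cvg mp erg A0 Acvg close ks.
split.
  by apply: (@poisson_of_moments (fun l => condm mu (mA l))) => ks; case: (moments ks).
by apply: (@poisson_of_moments (fun=> mu)) => ks; case: (moments ks).
Qed.

Lemma inP_condm l : inP mu (condm mu (mA l)).
Proof.
split.
- exact: measure0.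
- by move=> B _; exact: measure_ge0.
- exact: measure_semi_sigma_additive.
- exact: probability_setT.
- move=> B mB B0; rewrite condmE//.
  suff -> : mu (B `&` A l) = 0%E by rewrite mul0e.
  apply/eqP; rewrite eq_le measure_ge0 andbT -B0 le_measure ?inE//.
  exact: measurableI.
Qed.

Lemma dP_condm_self l (e : R) : 0 < e ->
  (dP (condm mu (mA l)) (condm mu (mA l)) < e%:E)%E.
Proof.
move=> e0; apply: (@le_lt_trans _ _ 0%E); last by rewrite lte_fin.
rewrite /dP mule_ge0_le0//; apply: ge_ereal_sup => _ [B mB <-].
by rewrite subee ?abse0// fin_num_measure.
Qed.

End PoissonAsymptotics.

Local Open Scope ereal_scope.

Theorem mainTheorem2 (d : measure_display) (X : measurableType d) (R : realType)
  (mu : probability X R) (T : X -> X) (A : nat -> set X)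
  (mA : forall l, measurable (A l)) :
  measure_preserving mu T -> ergodic mu T ->
  (forall l, 0 < mu (A l)) -> mu (A l) @[l --> \oo] --> 0 ->
  (* first version: nu_l := mu_{A_l} *)
  ((exists tau : nat -> X -> nat,
      conditions123 mu T A (fun l => condm mu (mA l) : set X -> \bar R) tau) ->
    weak_cvg_Exp (fun l => condm mu (mA l)) (fun l => scaled_Phi mu T (A l)) /\
    weak_cvg_Exp (fun l => mu : {measure set X -> \bar R}) (fun l => scaled_Phi mu T (A l)))
  /\
  (* general version *)
  ((forall eps : R, (0 < eps)%R ->
      exists (nu : nat -> set X -> \bar R) (tau : nat -> X -> nat),
        (forall l, inP mu (nu l)) /\
        (forall l, dP (nu l) (condm mu (mA l)) < eps%:E) /\
        conditions123 mu T A nu tau) ->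
    weak_cvg_Exp (fun l => condm mu (mA l)) (fun l => scaled_Phi mu T (A l)) /\
    weak_cvg_Exp (fun l => mu : {measure set X -> \bar R}) (fun l => scaled_Phi mu T (A l))).
Proof.
move=> mp erg A0 Acvg; split; last exact: poisson_of_close.
(* The first version is the general one with [nu] equal to [mu_A], at distance zero, for every
   [eps]. *)
move=> [tau htau]; apply: poisson_of_close => // eps eps0.
exists (fun l => condm mu (mA l)), tau; split; first by move=> l; exact: inP_condm.
by split => // l; exact: dP_condm_self.
Qed.
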